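(* Suppose that $\mathbf{f}\in\mathcal{C}^{\gamma+1}([t_0,T]\times\mathcal{D},\mathbb{R}^d)$. Then there are positive constants $C_1(\mathbf{x}_0)$ and $C_2(\mathbf{x}_0)$ depending only on $\mathbf{x}_0$ (the ODE, the time interval and the Runge-Kutta coefficients being fixed) such that, for all $h$ small enough and every time partition $(t)_h$, $$\left\Vert \mathbf{x}(t_n+h;\mathbf{x}_0)-\mathbf{x}(t_n;\mathbf{x}_0)-h\,\boldsymbol{\varphi}_\gamma(t_n,\mathbf{x}(t_n;\mathbf{x}_0);h)\right\Vert\le C_1(\mathbf{x}_0)h^{\gamma+1}$$ for all $t_n\in(t)_h$ with $t_n+h\le T$, and the LLRK discretization $\mathbf{y}_{n+1}=\mathbf{y}_n+h_n\boldsymbol{\varphi}_\gamma(t_n,\mathbf{y}_n;h_n)$, $\mathbf{y}_0=\mathbf{x}_0$, satisfies $$\left\Vert \mathbf{x}(t_{n+1};\mathbf{x}_0)-\mathbf{y}_{n+1}\right\Vert\le C_2(\mathbf{x}_0)h^{\gamma}$$ for all $t_{n+1}\in(t)_h$.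
   Context: $\mathcal{D}\subset\mathbb{R}^d$ is open, $\mathbf{f}:[t_0,T]\times\mathcal{D}\to\mathbb{R}^d$, $\mathbf{x}_0\in\mathcal{D}$, and $\mathbf{x}(t;\mathbf{x}_0)$ denotes the unique solution in $\mathcal{D}$, assumed to exist on $[t_0,T]$, of $\mathbf{x}'(t)=\mathbf{f}(t,\mathbf{x}(t))$, $\mathbf{x}(t_0)=\mathbf{x}_0$. $\mathbf{f}_{\mathbf{x}}$ and $\mathbf{f}_t$ denote the partial derivatives of $\mathbf{f}$. For $0<h<1$, $(t)_h$ denotes a partition $t_0<t_1<\dots<t_N=T$ with $h_n=t_{n+1}-t_n\le h$ for all $n$. Let $$\boldsymbol{\phi}(t,\mathbf{y};\delta)=\int_0^{\delta}e^{\mathbf{f}_{\mathbf{x}}(t,\mathbf{y})(\delta-u)}\left(\mathbf{f}(t,\mathbf{y})+\mathbf{f}_t(t,\mathbf{y})u\right)du,$$ $$\mathbf{q}(t,\mathbf{y};s,\boldsymbol{\xi})=\mathbf{f}(s,\mathbf{y}+\boldsymbol{\phi}(t,\mathbf{y};s-t)+\boldsymbol{\xi})-\mathbf{f}_{\mathbf{x}}(t,\mathbf{y})\boldsymbol{\phi}(t,\mathbf{y};s-t)-\mathbf{f}_t(t,\mathbf{y})(s-t)-\mathbf{f}(t,\mathbf{y}).$$ Fix an integer $\gamma>2$ and an explicit $s$-stage Runge-Kutta (RK) scheme of order $\gamma$ (in the usual sense) with coefficients $c_i,a_{ij},b_j$. Applied to the auxiliary ODE $\mathbf{u}'(t)=\mathbf{q}(t_n,\mathbf{y}_n;t,\mathbf{u}(t))$,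 $\mathbf{u}(t_n)=\mathbf{0}$, it yields $$\boldsymbol{\rho}(t_n,\mathbf{y}_n;\delta)=\delta\sum_{j=1}^s b_j\mathbf{k}_j,\qquad \mathbf{k}_i=\mathbf{q}\Big(t_n,\mathbf{y}_n;\,t_n+c_i\delta,\,\delta\sum_{j=1}^{i-1}a_{ij}\mathbf{k}_j\Big).$$ Stage times $t_n+c_i\delta$ are understood to lie in $[t_0,T]$. Set $\boldsymbol{\varphi}_\gamma(t_n,\mathbf{y}_n;\delta)=\frac1\delta\{\boldsymbol{\phi}(t_n,\mathbf{y}_n;\delta)+\boldsymbol{\rho}(t_n,\mathbf{y}_n;\delta)\}$. This recursion is the Local Linearization-Runge Kutta (LLRK) discretization of order $\gamma$. *)

(* Defs.v *)
From HB Require Import structures.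
From mathcomp Require Import all_boot all_order all_algebra.
From mathcomp Require Import all_classical all_reals all_analysis.
Set Implicit Arguments.
Unset Strict Implicit.
Unset Printing Implicit Defensive.
Import Order.TTheory GRing.Theory Num.Theory.
Import numFieldNormedType.Exports.
Local Open Scope classical_set_scope.
Local Open Scope ring_scope.

(* Vectors of R^d are columns 'cV[R]_d and `|v| is the library norm on them (the
   maximum norm).  Vector fields are total functions R -> 'cV[R]_d -> 'cV[R]_d;
   only their values on [a, b] x E are ever constrained. *)

Section Calculus.
Context {R : realType} {d : nat}.
Implicit Types (a b t : R) (E : set 'cV[R]_d).

(* Derivatives in time are taken relative to [a, b]: two-sided inside the
   interval, one-sided at its end points. *)
Definition diff_quot_in a b {W : normedModType R} (g : R -> W) t : set_system W :=
  h^-1 *: (g (t + h) - g t) @[h --> within [set h | a <= t + h <= b] 0^'].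

Definition is_derive_in a b {W : normedModType R} (g : R -> W) t (l : W) : Prop :=
  diff_quot_in a b g t --> l.

Definition derivable_in a b {W : normedModType R} (g : R -> W) t : Prop :=
  exists l, is_derive_in a b g t l.

Definition derive_in a b {W : normedModType R} (g : R -> W) t : W :=
  lim (diff_quot_in a b g t).

Definition partial_t a b (g : R -> 'cV[R]_d -> 'cV[R]_d) t (y : 'cV[R]_d) : 'cV[R]_d :=
  derive_in a b (fun s => g s y) t.

Definition partial_x (i : 'I_d) (g : R -> 'cV[R]_d -> 'cV[R]_d) t (y : 'cV[R]_d) :
  'cV[R]_d := 'D_(delta_mx i 0) (g t) y.

Definition jacobian_x (g : R -> 'cV[R]_d -> 'cV[R]_d) t (y : 'cV[R]_d) : 'M[R]_d :=
  \matrix_(i, j) partial_x j g t y i 0.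

(* g is of class C^k on [a, b] x E, for an open set E. *)
Fixpoint Ck (k : nat) a b E (g : R -> 'cV[R]_d -> 'cV[R]_d) : Prop :=
  {within `[a, b] `*` E, continuous (fun p : R * 'cV[R]_d => g p.1 p.2)} /\
  if k is k'.+1 then
    [/\ forall t y, a <= t <= b -> E y ->
          derivable_in a b (fun s => g s y) t /\
          forall i : 'I_d, derivable (g t) y (delta_mx i 0),
        Ck k' a b E (partial_t a b g)
      & forall i : 'I_d, Ck k' a b E (partial_x i g)]
  else True.

(* v solves v' = g(t, v) on [a, b] with values in E. *)
Definition ode_solution a b E (g : R -> 'cV[R]_d -> 'cV[R]_d) (v : R -> 'cV[R]_d) : Prop :=
  forall t, a <= t <= b -> E (v t) /\ is_derive_in a b v t (g t (v t)).

Definition unique_ivp_solution a b E (g : R -> 'cV[R]_d -> 'cV[R]_d)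
    (v0 : 'cV[R]_d) (v : R -> 'cV[R]_d) : Prop :=
  [/\ ode_solution a b E g v, v a = v0
    & forall w, ode_solution a b E g w -> w a = v0 ->
        forall t, a <= t <= b -> w t = v t].

Definition mexp (A : 'M[R]_d) : 'M[R]_d :=
  lim (series (fun k => (k`!%:R)^-1 *: A ^+ k) @ \oo).

(* The oriented integral of F from 0 to delta, entry by entry. *)
Definition oriented_integral (F : R -> 'cV[R]_d) (delta : R) : 'cV[R]_d :=
  \col_i (if 0 <= delta
          then \int[lebesgue_measure]_(u in `[0, delta]) F u i 0
          else - \int[lebesgue_measure]_(u in `[delta, 0]) F u i 0).

End Calculus.

(* An explicit s-stage tableau; only the entries rk_a i j with j < i are used. *)
Record rk_tableau (R : realType) (s : nat) := RKTableau {
  rk_c : 'I_s -> R;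
  rk_a : 'I_s -> 'I_s -> R;
  rk_b : 'I_s -> R }.

Section RungeKutta.
Context {R : realType} {s : nat} (S : rk_tableau R s) {m : nat}.

(* The recursion is run with fuel: i.+1 units determine the i-th stage, see
   rk_stageE. *)
Fixpoint rk_stage_fuel (g : R -> 'cV[R]_m -> 'cV[R]_m) (tau : R) (v0 : 'cV[R]_m)
    (delta : R) (fuel : nat) (i : 'I_s) : 'cV[R]_m :=
  if fuel is fuel'.+1 then
    g (tau + rk_c S i * delta)
      (v0 + delta *: \sum_(j < s | (j < i)%N)
                       rk_a S i j *: rk_stage_fuel g tau v0 delta fuel' j)
  else 0.

Definition rk_stage (g : R -> 'cV[R]_m -> 'cV[R]_m) (tau : R) (v0 : 'cV[R]_m)
    (delta : R) (i : 'I_s) : 'cV[R]_m := rk_stage_fuel g tau v0 delta i.+1 i.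

Lemma rk_stageE g tau v0 delta i :
  rk_stage g tau v0 delta i =
  g (tau + rk_c S i * delta)
    (v0 + delta *: \sum_(j < s | (j < i)%N) rk_a S i j *: rk_stage g tau v0 delta j).
Proof.
have fuelE n k (j : 'I_s) : (j < n)%N -> (j < k)%N ->
    rk_stage_fuel g tau v0 delta n j = rk_stage_fuel g tau v0 delta k j.
  elim: n k j => [|n IHn] [|k] j //= jn jk.
  congr (g _ (_ + _ *: _)); apply: eq_bigr => l lj.
  by rewrite (IHn k) // (leq_trans lj).
rewrite {1}/rk_stage /=; congr (g _ (_ + _ *: _)); apply: eq_bigr => j ji.
by rewrite /rk_stage (fuelE i j.+1).
Qed.

Definition rk_increment (g : R -> 'cV[R]_m -> 'cV[R]_m) (tau : R) (v0 : 'cV[R]_m)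
    (delta : R) : 'cV[R]_m :=
  delta *: \sum_(j < s) rk_b S j *: rk_stage g tau v0 delta j.

(* All stage times of a step of length delta from tau lie in [a, b]. *)
Definition stage_times_in (a b tau delta : R) : Prop :=
  forall i : 'I_s, a <= tau + rk_c S i * delta <= b.

End RungeKutta.

(* Order p: for every sufficiently smooth (here: C^(p+1)) initial value problem, in
   any dimension, the local error of one step of length delta is O(delta^(p+1)). *)
Definition rk_order {R : realType} {s : nat} (S : rk_tableau R s) (p : nat) : Prop :=
  forall (m : nat) (a b : R) (E : set 'cV[R]_m) (g : R -> 'cV[R]_m -> 'cV[R]_m)
         (tau : R) (v : R -> 'cV[R]_m),
    open E -> Ck p.+1 a b E g -> a <= tau < b -> ode_solution tau b E g v ->
    exists K delta0 : R, 0 < delta0 /\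
      forall delta, 0 < delta < delta0 -> tau + delta <= b ->
        stage_times_in S a b tau delta ->
        `|v (tau + delta) - v tau - rk_increment S g tau (v tau) delta|
          <= K * delta ^+ p.+1.

Section LocalLinearizationRK.
Context {R : realType} {d s : nat}.
Variables (t0 T : R) (f : R -> 'cV[R]_d -> 'cV[R]_d) (S : rk_tableau R s).

Definition ll_phi (t : R) (y : 'cV[R]_d) (delta : R) : 'cV[R]_d :=
  oriented_integral (fun u => mexp ((delta - u) *: jacobian_x f t y)
                        *m (f t y + u *: partial_t t0 T f t y)) delta.

Definition ll_q (t : R) (y : 'cV[R]_d) (r : R) (xi : 'cV[R]_d) : 'cV[R]_d :=
  f r (y + ll_phi t y (r - t) + xi) - jacobian_x f t y *m ll_phi t y (r - t)
    - (r - t) *: partial_t t0 T f t y - f t y.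

Definition llrk_rho (t : R) (y : 'cV[R]_d) (delta : R) : 'cV[R]_d :=
  rk_increment S (ll_q t y) t 0 delta.

Definition llrk_phi (t : R) (y : 'cV[R]_d) (delta : R) : 'cV[R]_d :=
  delta^-1 *: (ll_phi t y delta + llrk_rho t y delta).

End LocalLinearizationRK.

(* tt 0 < tt 1 < ... < tt N is a partition of [t0, T] of mesh at most h. *)
Definition time_partition {R : realType} (t0 T h : R) (N : nat) (tt : nat -> R) : Prop :=
  [/\ tt 0%N = t0, tt N = T
    & forall n, (n < N)%N -> tt n < tt n.+1 /\ tt n.+1 - tt n <= h].

(* Main.v *)
(* Let u(t) = x(t) - x(tau) - phi(tau, x(tau); t - tau).  Since phi(tau, y; .) solves
   phi' = J phi + f + r f_t, the function u solves the auxiliary problem exactly, so the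
   local error of an LLRK step is the Runge-Kutta local error for that problem.

   The order hypothesis bounds this error by K r^(gamma+1) with K depending on the
   starting time tau.  To make K uniform, view the error as a family of functions of the
   step r indexed by (tau, h): it is built from x, phi and the stages, hence it has
   gamma+1 derivatives in r bounded uniformly in (tau, h).  The order hypothesis makes its
   Taylor coefficients up to order gamma vanish for each tau, and the uniform Taylor
   remainder gives the uniform bound.

   The increment function is Lipschitz in y on a tube around the trajectory, so a discrete
   Gronwall argument, which also keeps y_n in the tube, gives the global bound. *)
Require Import Defs.
From HB Require Import structures.
From mathcomp Require Import all_boot all_order all_algebra.
From mathcomp Require Import all_classical all_reals all_analysis.
From mathcomp Require Import ring lra.
Import Order.TTheory GRing.Theory Num.Theory.
Import numFieldNormedType.Exports.
Local Open Scope classical_set_scope.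
Local Open Scope ring_scope.
Set Implicit Arguments.
Unset Strict Implicit.
Unset Printing Implicit Defensive.

(** Two notions of smoothness coexist. [Ck] is imposed on [f] by the statement and on the auxiliary
    field by [rk_order]; it speaks of partial derivatives one at a time and carries no uniform
    bound. [Cb] carries a parameter, uniform bounds and joint first-order expansions relative to
    arbitrary sets, so that closed tubes, end points of the interval and curves are treated alike,
    and it is stable under composition. The argument passes from [Ck] to [Cb] for [f], by
    compactness of [t0, T], and back from [Cb] to [Ck] for the auxiliary field only.

    Uniformity in tau is cheap because the error is differentiated in the step r alone: f, f_t and
    the Jacobian at (tau, x(tau)) enter as bounded constants, and no regularity in tau is used.

    The matrix exponential serves to show that phi solves its linear equation; bounds, Lipschitz
    estimates and smoothness of phi are then read off that equation. The nodes c_i may be negative,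
    so phi is controlled for both signs of r. *)

Lemma subr3DD (V : zmodType) (x x' y y' l l' : V) :
  x + x' - (y + y') - (l + l') = (x - y - l) + (x' - y' - l').
Proof. by rewrite !opprD [x + x' + _]addrACA [LHS]addrACA. Qed.

(** * Norms and derivatives relative to a set *)

Section MatrixNorm.
Context {R : realType}.

Lemma mx_norm_le m n (A : 'M[R]_(m, n)) (M : R) :
  0 <= M -> (forall i j, `|A i j| <= M) -> `|A| <= M.
Proof.
by move=> M0 AM; rewrite /Num.Def.normr/= mx_normrE; apply: bigmax_le.
Qed.

Lemma mx_norm_ge m n (A : 'M[R]_(m, n)) i j : `|A i j| <= `|A|.
Proof.
rewrite [leRHS]/Num.Def.normr/= mx_normrE.
exact: (@le_bigmax _ _ _ 0 (fun ij : 'I_m * 'I_n => `|A ij.1 ij.2|) (i, j)).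
Qed.

Lemma mx_norm_mulmx m n p (A : 'M[R]_(m, n)) (B : 'M[R]_(n, p)) :
  `|A *m B| <= n%:R * `|A| * `|B|.
Proof.
apply: mx_norm_le => [|i j]; first by rewrite !mulr_ge0.
rewrite mxE (le_trans (ler_norm_sum _ _ _))//.
apply: (@le_trans _ _ (\sum_(k < n) `|A| * `|B|)); last first.
  by rewrite sumr_const card_ord -mulrA mulr_natl.
by apply: ler_sum => k _; rewrite normrM ler_pM// mx_norm_ge.
Qed.

Lemma mulmx_sum_col m n (A : 'M[R]_(m, n)) (v : 'cV[R]_n) :
  A *m v = \sum_i v i 0 *: col i A.
Proof.
apply/colP => k; rewrite mxE summxE; apply: eq_bigr => i _.
by rewrite !mxE mulrC.
Qed.

Lemma cV_sum_delta n (v : 'cV[R]_n) : v = \sum_i v i 0 *: delta_mx i 0.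
Proof. by rewrite {1}(matrix_sum_delta v); apply: eq_bigr => i _; rewrite big_ord1. Qed.

End MatrixNorm.

Section DerivOn.
Context {R : realType}.

(** An epsilon-eta form of differentiability relative to [A], equivalent to [is_derive_in] when [A]
    is the interval ([is_derive_inP]). Nothing forces [t] to be a limit point of [A], so it passes
    to subsets freely, at the price of uniqueness of [l]. *)
Definition deriv_on (A : set R) (V : normedModType R) (g : R -> V) t (l : V) :=
  forall e, 0 < e -> exists2 eta, 0 < eta & forall s, A s -> `|s - t| < eta ->
    `|g s - g t - (s - t) *: l| <= e * `|s - t|.

Context {V : normedModType R}.
Implicit Types (A : set R) (g : R -> V).

Lemma deriv_on_sub A B g t l : A `<=` B -> deriv_on B g t l -> deriv_on A g t l.
Proof.
move=> AB H e /H[eta eta0 He]; exists eta => // s /AB; exact: He.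
Qed.

Lemma deriv_on_ext A g g' t l : A t -> (forall s, A s -> g s = g' s) ->
  deriv_on A g t l -> deriv_on A g' t l.
Proof.
move=> At gg' H e /H[eta eta0 He]; exists eta => // s As st.
by rewrite -!gg'//; exact: He.
Qed.

Lemma deriv_onD A g g' t l l' : deriv_on A g t l -> deriv_on A g' t l' ->
  deriv_on A (fun s => g s + g' s) t (l + l').
Proof.
move=> H H' e e0; have e2 : 0 < e / 2 by rewrite divr_gt0.
have [eta eta0 He] := H _ e2; have [eta' eta'0 He'] := H' _ e2.
exists (Num.min eta eta'); first by rewrite lt_min eta0.
move=> s As; rewrite lt_min => /andP[h1 h2].
rewrite scalerDr subr3DD (le_trans (ler_normD _ _))//.
have := He _ As h1; have := He' _ As h2; lra.
Qed.

Lemma deriv_onZ A g t l (k : R) : deriv_on A g t l ->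
  deriv_on A (fun s => k *: g s) t (k *: l).
Proof.
move=> H e e0; have k1 : 0 < `|k| + 1 by apply: ltr_wpDl.
have [eta eta0 He] := H _ (divr_gt0 e0 k1).
exists eta => // s As st.
rewrite scalerA mulrC -scalerA -!scalerBr normrZ.
apply: (@le_trans _ _ ((`|k| + 1) * (e / (`|k| + 1) * `|s - t|))).
  by apply: ler_pM => //; [rewrite lerDl|exact: He].
by rewrite mulrA [_ * (e / _)]mulrC divfK ?gt_eqF.
Qed.

Lemma deriv_onB A g g' t l l' : deriv_on A g t l -> deriv_on A g' t l' ->
  deriv_on A (fun s => g s - g' s) t (l - l').
Proof.
move=> H /(deriv_onZ (-1)) H'; have := deriv_onD H H'.
by rewrite scaleN1r; congr (deriv_on _ _ _ _); apply/funext => s; rewrite scaleN1r.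
Qed.

Lemma deriv_on_cst A (v : V) t : deriv_on A (fun=> v) t 0.
Proof.
by move=> e e0; exists 1 => // s _ _; rewrite subrr scaler0 subrr normr0 mulr_ge0// ltW.
Qed.

Lemma deriv_on_affine A g t l (k nu : R) B :
  (forall s, A s -> B (k * s + nu)) ->
  deriv_on B g (k * t + nu) l -> deriv_on A (fun s => g (k * s + nu)) t (k *: l).
Proof.
move=> AB H e e0; have k1 : 0 < `|k| + 1 by apply: ltr_wpDl.
have [eta eta0 He] := H (e / (`|k| + 1)) (divr_gt0 e0 k1).
exists (eta / (`|k| + 1)) => [|s As st]; first exact: divr_gt0.
have E : k * s + nu - (k * t + nu) = k * (s - t) by ring.
rewrite scalerA [_ * k]mulrC -E.
apply: (@le_trans _ _ (e / (`|k| + 1) * `|k * s + nu - (k * t + nu)|)).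
  apply: He; first exact: AB.
  rewrite E normrM; apply: (@le_lt_trans _ _ ((`|k| + 1) * `|s - t|)).
    by rewrite ler_wpM2r// lerDl.
  by rewrite mulrC -ltr_pdivlMr.
rewrite E normrM mulrA ler_wpM2r// -mulrA ger_pMr// mulrC.
by rewrite ler_pdivrMr// mul1r lerDl.
Qed.

Lemma deriv_on_lip A g t l : deriv_on A g t l -> forall M, `|l| < M ->
  exists2 eta, 0 < eta & forall s, A s -> `|s - t| < eta -> `|g s - g t| <= M * `|s - t|.
Proof.
move=> H M lM; have e0 : 0 < M - `|l| by rewrite subr_gt0.
have [eta eta0 He] := H _ e0; exists eta => // s As st.
have := He _ As st; have := ler_normD (g s - g t - (s - t) *: l) ((s - t) *: l).
rewrite subrK normrZ; lra.
Qed.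

Lemma deriv_on_cont A g t l : deriv_on A g t l -> forall e, 0 < e ->
  exists2 eta, 0 < eta & forall s, A s -> `|s - t| < eta -> `|g s - g t| < e.
Proof.
move=> H e e0; have [] := deriv_on_lip H (M := `|l| + 1); first by rewrite ltrDl.
move=> eta eta0 He; have l1 : 0 < `|l| + 1 by apply: ltr_wpDl.
exists (Num.min eta (e / (`|l| + 1))); first by rewrite lt_min eta0 divr_gt0.
move=> s As; rewrite lt_min => /andP[h1 h2].
by apply: le_lt_trans (He _ As h1) _; rewrite mulrC -ltr_pdivlMr.
Qed.

(** Values are vectors, so there is no mean value equality to appeal to. The slope is relaxed to
    [M + e]; the supremum of the points where the relaxed bound holds satisfies it too, and equals
    [b], since otherwise differentiability there pushes the bound further. *)
Lemma mean_value_bound g (dg : R -> V) a b M : a <= b ->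
  (forall t, a <= t <= b -> deriv_on [set s | a <= s <= b] g t (dg t)) ->
  (forall t, a <= t <= b -> `|dg t| <= M) -> `|g b - g a| <= M * (b - a).
Proof.
move=> ab Hd HM; apply/ler_addgt0Pr => e0 e00.
have ba1 : 0 < b - a + 1 by lra.
set e := e0 / (b - a + 1); have e_gt0 : 0 < e by apply: divr_gt0.
suff : `|g b - g a| <= (M + e) * (b - a).
  move=> /le_trans; apply; rewrite mulrDl lerD2l.
  by rewrite /e mulrAC ler_pdivrMr// ler_pM2l//; lra.
have loc t : a <= t <= b -> exists2 eta, 0 < eta & forall s, a <= s <= b ->
    `|s - t| < eta -> `|g s - g t| <= (M + e) * `|s - t|.
  move=> tab; apply: (deriv_on_lip (Hd _ tab)); have := HM _ tab; lra.
pose S := [set t | a <= t <= b /\ `|g t - g a| <= (M + e) * (t - a)].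
have Sa : S a by split; [lra|rewrite !subrr mulr0 normr0].
have ubS : ubound S b by move=> t [/andP[]].
have supS : has_sup S by split; [exists a|exists b].
set c := sup S.
have cab : a <= c <= b.
  by apply/andP; split; [exact: sup_upper_bound|apply: ge_sup => //; exists a].
have [eta eta0 He] := loc _ cab.
have Sc : S c.
  split=> //; have [t [tab St] ct] := sup_adherent eta0 supS.
  have tc : t <= c by apply: sup_upper_bound.
  have := He t tab; rewrite distrC (distrC (g t)) ger0_norm ?subr_ge0// => /(_ _).
  have -> : c - t < eta by rewrite -/c in ct; lra.
  move=> /(_ isT) h; have -> : g c - g a = (g c - g t) + (g t - g a) by rewrite addrA subrK.
  rewrite (le_trans (ler_normD _ _))//; lra.
have [<-|cb] := eqVneq c b; first by case: Sc.
have {}cb : c < b by rewrite lt_neqAle cb; case/andP: cab.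
pose s := Num.min b (c + eta / 2).
have cs : c < s by rewrite lt_min cb; lra.
have sb : s <= b by rewrite ge_min lexx.
have se : s <= c + eta / 2 by rewrite ge_min lexx orbT.
suff /(sup_upper_bound supS) : S s by rewrite -/c; lra.
split; first by lra.
have := He s; rewrite gtr0_norm ?subr_gt0// => /(_ _ _) h.
have {}h : `|g s - g c| <= (M + e) * (s - c) by apply: h; lra.
have -> : g s - g a = (g s - g c) + (g c - g a) by rewrite addrA subrK.
rewrite (le_trans (ler_normD _ _))//; case: Sc; lra.
Qed.

End DerivOn.

Lemma divr_succ_mul_le {R : realFieldType} (e k : R) :
  0 < e -> 0 <= k -> k * (e / (k + 1)) <= e.
Proof.
move=> e0 k0; have k1 : 0 < k + 1 by apply: ltr_wpDl.
by rewrite mulrA ler_pdivrMr// mulrC ler_pM2l// lerDl.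
Qed.

(** * Joint differentiability in time and space, relative to a set *)

Section Frechet.
Context {R : realType}.

Definition pdist {m} (t' t : R) (y' y : 'cV[R]_m) : R := `|t' - t| + `|y' - y|.

Lemma pdist_ge0 {m} t' t (y' y : 'cV[R]_m) : 0 <= pdist t' t y' y.
Proof. exact: addr_ge0. Qed.

Definition lin {m} {V : normedModType R} (ft : V) (fx : 'I_m -> V) (r : R)
  (v : 'cV[R]_m) : V := r *: ft + \sum_i v i 0 *: fx i.

Definition lin_norm {m} {V : normedModType R} (ft : V) (fx : 'I_m -> V) : R :=
  `|ft| + \sum_i `|fx i|.

Definition cont_at {m} {V : normedModType R} (O : R -> 'cV[R]_m -> Prop)
  (F : R -> 'cV[R]_m -> V) t y := forall e, 0 < e -> exists2 eta, 0 < eta &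
  forall t' y', O t' y' -> pdist t' t y' y < eta -> `|F t' y' - F t y| < e.

(** A joint expansion, since partial derivatives alone do not yield a chain rule. Relative to [O] it
    is one-sided at the ends of a time interval, and for [m = 0] it amounts to [deriv_on]. *)
Definition frechet {m} {V : normedModType R} (O : R -> 'cV[R]_m -> Prop)
  (F : R -> 'cV[R]_m -> V) t y ft fx := forall e, 0 < e -> exists2 eta, 0 < eta &
  forall t' y', O t' y' -> pdist t' t y' y < eta ->
    `|F t' y' - F t y - lin ft fx (t' - t) (y' - y)| <= e * pdist t' t y' y.

Section Lin.
Context {m : nat} {V : normedModType R}.
Implicit Types (ft : V) (fx : 'I_m -> V).

Lemma lin_norm_ge0 ft fx : 0 <= lin_norm ft fx.
Proof. by rewrite addr_ge0// sumr_ge0. Qed.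

Lemma lin_bound ft fx r v : `|lin ft fx r v| <= lin_norm ft fx * (`|r| + `|v|).
Proof.
rewrite /lin /lin_norm (le_trans (ler_normD _ _))// normrZ mulrDl.
rewrite mulrC lerD//; first by rewrite ler_wpM2l// lerDl.
rewrite (le_trans (ler_norm_sum _ _ _))// mulr_suml ler_sum// => i _.
rewrite normrZ mulrC ler_wpM2l//.
by rewrite (le_trans (mx_norm_ge v i 0))// lerDr.
Qed.

Lemma linD ft fx gt gx r v :
  lin (ft + gt) (fun i => fx i + gx i) r v = lin ft fx r v + lin gt gx r v.
Proof.
rewrite /lin scalerDr addrACA; congr (_ + _).
by rewrite -big_split; apply: eq_bigr => i _; rewrite scalerDr.
Qed.

Lemma linZ k ft fx r v :
  lin (k *: ft) (fun i => k *: fx i) r v = k *: lin ft fx r v.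
Proof.
rewrite /lin scalerDr !scalerA mulrC; congr (_ + _).
by rewrite scaler_sumr; apply: eq_bigr => i _; rewrite !scalerA mulrC.
Qed.

Lemma lin_argD ft fx r s v w :
  lin ft fx (r + s) (v + w) = lin ft fx r v + lin ft fx s w.
Proof.
rewrite /lin scalerDl addrACA; congr (_ + _).
by rewrite -big_split; apply: eq_bigr => i _; rewrite mxE scalerDl.
Qed.

Lemma lin_argZ ft fx k r v : lin ft fx (k * r) (k *: v) = k *: lin ft fx r v.
Proof.
rewrite /lin scalerDr scalerA; congr (_ + _).
by rewrite scaler_sumr; apply: eq_bigr => i _; rewrite mxE scalerA.
Qed.

Lemma lin_argB ft fx r s v w :
  lin ft fx (r - s) (v - w) = lin ft fx r v - lin ft fx s w.
Proof.
rewrite lin_argD; congr (_ + _).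
by rewrite -[- w]scaleN1r -[- s]mulN1r lin_argZ scaleN1r.
Qed.

Lemma lin_arg0 ft fx : lin ft fx 0 0 = 0.
Proof. by rewrite -(subrr (0 : R)) -(subrr (0 : 'cV[R]_m)) lin_argB subrr. Qed.

End Lin.

Lemma lin_scale m (V : normedModType R) (at_ : R) (ax : 'I_m -> R) r v (G : V) :
  lin (at_ *: G) (fun i => ax i *: G) r v = lin (at_ : R) ax r v *: G.
Proof.
rewrite /lin scalerDl scalerA; congr (_ + _).
by rewrite scaler_suml; apply: eq_bigr => i _; rewrite scalerA.
Qed.

(** The algebra of the chain rule: the differential of a composite, assembled from partial
    derivatives computed one by one, is the composite of the differentials. *)
Lemma lin_comp m n (V : normedModType R) (ft : V) (fx : 'I_n -> V)
    (tt : R) (tx : 'I_m -> R) (yt : 'cV[R]_n) (yx : 'I_m -> 'cV[R]_n) r v :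
  lin (lin ft fx tt yt) (fun j => lin ft fx (tx j) (yx j)) r v =
  lin ft fx (lin tt tx r v) (lin yt yx r v).
Proof.
rewrite {1}/lin -lin_argZ [lin tt tx r v]/lin [lin yt yx r v]/lin lin_argD; congr (_ + _).
elim/big_rec3: _ => [|i u w z _ ->]; first by rewrite lin_arg0.
by rewrite lin_argD -lin_argZ.
Qed.

Section Calculus.
Context {m : nat} {V : normedModType R}.
Variables (O : R -> 'cV[R]_m -> Prop) (t : R) (y : 'cV[R]_m).
Implicit Types (F G : R -> 'cV[R]_m -> V).

Lemma frechet_lip F ft fx : frechet O F t y ft fx -> exists2 eta, 0 < eta &
  forall t' y', O t' y' -> pdist t' t y' y < eta ->
    `|F t' y' - F t y| <= (lin_norm ft fx + 1) * pdist t' t y' y.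
Proof.
move=> /(_ 1 ltr01)[eta eta0 H]; exists eta => // t' y' Oy N.
rewrite -[F t' y' - _](subrK (lin ft fx (t' - t) (y' - y))).
rewrite (le_trans (ler_normD _ _))// mulrDl addrC lerD//; last exact: H.
exact: lin_bound.
Qed.

Lemma frechet_cont F ft fx : frechet O F t y ft fx -> cont_at O F t y.
Proof.
move=> /frechet_lip[eta eta0 H] e e0.
have l1 : 0 < lin_norm ft fx + 1 by rewrite ltr_wpDl// lin_norm_ge0.
exists (Num.min eta (e / (lin_norm ft fx + 1))); first by rewrite lt_min eta0 divr_gt0.
move=> t' y' Oy; rewrite lt_min => /andP[h1 h2].
by apply: le_lt_trans (H _ _ Oy h1) _; rewrite mulrC -ltr_pdivlMr.
Qed.

Lemma frechet_ext F G ft fx : O t y -> (forall t y, O t y -> F t y = G t y) ->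
  frechet O F t y ft fx -> frechet O G t y ft fx.
Proof.
move=> Oty FG H e /H[eta eta0 He]; exists eta => // t' y' Oy N.
by rewrite -!FG//; exact: He.
Qed.

Lemma cont_at_ext F G : O t y -> (forall t y, O t y -> F t y = G t y) ->
  cont_at O F t y -> cont_at O G t y.
Proof.
move=> Oty FG H e /H[eta eta0 He]; exists eta => // t' y' Oy N.
by rewrite -!FG//; exact: He.
Qed.

Lemma frechet_cst (v : V) : frechet O (fun _ _ => v) t y 0 (fun=> 0).
Proof.
move=> e e0; exists 1 => // t' y' _ _.
rewrite /lin scaler0 big1 => [|i _]; last by rewrite scaler0.
by rewrite subrr addr0 subrr normr0 mulr_ge0 ?pdist_ge0// ltW.
Qed.

Lemma frechetD F G ft fx gt gx : frechet O F t y ft fx -> frechet O G t y gt gx ->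
  frechet O (fun t y => F t y + G t y) t y (ft + gt) (fun i => fx i + gx i).
Proof.
move=> HF HG e e0; have e2 : 0 < e / 2 by rewrite divr_gt0.
have [a a0 Ha] := HF _ e2; have [b b0 Hb] := HG _ e2.
exists (Num.min a b); first by rewrite lt_min a0.
move=> t' y' Oy; rewrite lt_min => /andP[h1 h2].
rewrite linD subr3DD (le_trans (ler_normD _ _))//.
have := Ha _ _ Oy h1; have := Hb _ _ Oy h2; lra.
Qed.

Lemma cont_atD F G : cont_at O F t y -> cont_at O G t y ->
  cont_at O (fun t y => F t y + G t y) t y.
Proof.
move=> HF HG e e0; have e2 : 0 < e / 2 by rewrite divr_gt0.
have [a a0 Ha] := HF _ e2; have [b b0 Hb] := HG _ e2.
exists (Num.min a b); first by rewrite lt_min a0.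
move=> t' y' Oy; rewrite lt_min => /andP[h1 h2].
rewrite opprD addrACA (le_lt_trans (ler_normD _ _))//.
have := Ha _ _ Oy h1; have := Hb _ _ Oy h2; lra.
Qed.

End Calculus.

Section Scaling.
Context {m : nat} {V : normedModType R}.
Variables (O : R -> 'cV[R]_m -> Prop) (t : R) (y : 'cV[R]_m).
Implicit Types (G : R -> 'cV[R]_m -> V).

Lemma scale_sub_expand (a a' : R) (u u' : V) :
  a' *: u' - a *: u = (a' - a) *: u + a *: (u' - u) + (a' - a) *: (u' - u).
Proof.
rewrite -addrA -scalerDl [a + _]addrC subrK scalerBl scalerBr.
by rewrite [RHS]addrC addrA subrK.
Qed.

Lemma cont_atZ (a : R -> 'cV[R]_m -> R) G : cont_at O a t y -> cont_at O G t y ->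
  cont_at O (fun t y => a t y *: G t y) t y.
Proof.
move=> Ha HG e e0; have e3 : 0 < e / 3 by rewrite divr_gt0.
pose M : R := Num.max 1 (Num.max (`|a t y| + 1) (`|G t y| + 1)).
have p1 : 0 < `|a t y| + 1 by apply: ltr_wpDl.
have p2 : 0 < `|G t y| + 1 by apply: ltr_wpDl.
have [b b0 Hb] := Ha _ (divr_gt0 e3 p2).
have [b' b'0 Hb'] := Ha _ e3.
have [c c0 Hc] := HG _ (divr_gt0 e3 p1).
have [c' c'0 Hc'] := HG _ ltr01.
exists (Num.min (Num.min b b') (Num.min c c')); first by rewrite !lt_min b0 b'0 c0.
move=> t' y' Oy; rewrite !lt_min => /andP[/andP[h1 h2] /andP[h3 h4]].
rewrite scale_sub_expand (le_lt_trans (ler_normD _ _))//.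
have A1 : `|(a t' y' - a t y) *: G t y| <= e / 3.
  rewrite normrZ mulrC; apply: le_trans (divr_succ_mul_le e3 (normr_ge0 (G t y))).
  by rewrite ler_wpM2l// ltW// Hb.
have A2 : `|a t y *: (G t' y' - G t y)| <= e / 3.
  rewrite normrZ; apply: le_trans (divr_succ_mul_le e3 (normr_ge0 (a t y))).
  by rewrite ler_wpM2l// ltW// Hc.
have A3 : `|(a t' y' - a t y) *: (G t' y' - G t y)| < e / 3.
  rewrite normrZ -[ltRHS]mulr1; apply: ltr_pM => //; [exact: Hb'|exact: Hc'].
have := ler_normD ((a t' y' - a t y) *: G t y) (a t y *: (G t' y' - G t y)); lra.
Qed.

Lemma frechetZ (a : R -> 'cV[R]_m -> R) at_ ax G gt gx :
  frechet O a t y at_ ax -> frechet O G t y gt gx ->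
  frechet O (fun t y => a t y *: G t y) t y
    (at_ *: G t y + a t y *: gt) (fun i => ax i *: G t y + a t y *: gx i).
Proof.
move=> Ha HG e e0; have e3 : 0 < e / 3 by rewrite divr_gt0.
have p1 : 0 < `|a t y| + 1 by apply: ltr_wpDl.
have p2 : 0 < `|G t y| + 1 by apply: ltr_wpDl.
have l0 := lin_norm_ge0 at_ ax; have p3 : 0 < lin_norm at_ ax + 1 by apply: ltr_wpDl.
have [b b0 Hb] := Ha _ (divr_gt0 e3 p2).
have [b' b'0 Hb'] := frechet_lip Ha.
have [c c0 Hc] := HG _ (divr_gt0 e3 p1).
have [c' c'0 Hc'] := frechet_cont HG (divr_gt0 e3 p3).
exists (Num.min (Num.min b b') (Num.min c c')); first by rewrite !lt_min b0 b'0 c0.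
move=> t' y' Oy; rewrite !lt_min => /andP[/andP[h1 h2] /andP[h3 h4]].
rewrite scale_sub_expand linD lin_scale linZ.
rewrite [_ + (a t' y' - a t y) *: _]addrC -addrA.
rewrite (le_trans (ler_normD _ _))//.
have N0 := pdist_ge0 t' t y' y; set N := pdist _ _ _ _ in N0 *.
(* The quadratic term: the increment of [a] is at most a multiple of [N] and that of [G] is small,
   so the product is o(N). *)
have A3 : `|(a t' y' - a t y) *: (G t' y' - G t y)| <= e / 3 * N.
  rewrite normrZ; apply: (@le_trans _ _ ((lin_norm at_ ax + 1) * N * (e / 3 / (lin_norm at_ ax + 1)))).
    by apply: ler_pM => //; [exact: Hb'|rewrite ltW// Hc'].
  by rewrite mulrAC [_ * (e / 3 / _)]mulrC divfK ?gt_eqF.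
have A1 : `|(a t' y' - a t y - lin at_ ax (t' - t) (y' - y)) *: G t y| <= e / 3 * N.
  rewrite normrZ mulrC; apply: (@le_trans _ _ (`|G t y| * (e / 3 / (`|G t y| + 1)) * N)).
    by rewrite -mulrA ler_wpM2l// Hb.
  by rewrite ler_wpM2r// divr_succ_mul_le.
have A2 : `|a t y *: (G t' y' - G t y - lin gt gx (t' - t) (y' - y))| <= e / 3 * N.
  rewrite normrZ; apply: (@le_trans _ _ (`|a t y| * (e / 3 / (`|a t y| + 1)) * N)).
    by rewrite -mulrA ler_wpM2l// Hc.
  by rewrite ler_wpM2r// divr_succ_mul_le.
rewrite opprD addrACA -scalerBl -scalerBr.
have := ler_normD ((a t' y' - a t y - lin at_ ax (t' - t) (y' - y)) *: G t y)
   (a t y *: (G t' y' - G t y - lin gt gx (t' - t) (y' - y))); lra.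
Qed.

End Scaling.

Section Composition.
Context {m n : nat} {V : normedModType R}.
Variables (O : R -> 'cV[R]_m -> Prop) (P : R -> 'cV[R]_n -> Prop).
Variables (F : R -> 'cV[R]_n -> V) (g : R -> 'cV[R]_m -> R) (G : R -> 'cV[R]_m -> 'cV[R]_n).
Hypothesis OP : forall t y, O t y -> P (g t y) (G t y).

Lemma cont_at_comp t y : cont_at O g t y -> cont_at O G t y ->
  cont_at P F (g t y) (G t y) -> cont_at O (fun t y => F (g t y) (G t y)) t y.
Proof.
move=> Hg HG HF e /HF[eta eta0 He]; have e2 : 0 < eta / 2 by rewrite divr_gt0.
have [a a0 Ha] := Hg _ e2; have [b b0 Hb] := HG _ e2.
exists (Num.min a b); first by rewrite lt_min a0.
move=> t' y' Oy; rewrite lt_min => /andP[h1 h2]; apply: He; first exact: OP.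
have := Ha _ _ Oy h1; have := Hb _ _ Oy h2; rewrite /pdist; lra.
Qed.

Lemma frechet_comp t y ft fx gt gx Gt Gx :
  frechet O g t y gt gx -> frechet O G t y Gt Gx ->
  frechet P F (g t y) (G t y) ft fx ->
  frechet O (fun t y => F (g t y) (G t y)) t y
    (lin ft fx gt Gt) (fun i => lin ft fx (gx i) (Gx i)).
Proof.
move=> Hg HG HF e e0; have e2 : 0 < e / 2 by rewrite divr_gt0.
set K := lin_norm gt gx + 1 + (lin_norm Gt Gx + 1).
have K0 : 0 < K by have := lin_norm_ge0 gt gx; have := lin_norm_ge0 Gt Gx; rewrite /K; lra.
set L := lin_norm ft fx; have L0 : 0 <= L := lin_norm_ge0 ft fx.
have [eta eta0 He] := HF _ (divr_gt0 e2 K0).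
have eK : 0 < eta / K by apply: divr_gt0.
have L1 : 0 < L + 1 by apply: ltr_wpDl.
have e4 : 0 < e / 4 by rewrite divr_gt0.
have [a a0 Ha] := Hg _ (divr_gt0 e4 L1); have [b b0 Hb] := HG _ (divr_gt0 e4 L1).
have [a' a'0 Ha'] := frechet_lip Hg; have [b' b'0 Hb'] := frechet_lip HG.
exists (Num.min (eta / K) (Num.min (Num.min a b) (Num.min a' b'))).
  by rewrite !lt_min eK a0 b0 a'0.
move=> t' y' Oy; rewrite !lt_min => /andP[h0 /andP[/andP[h1 h2] /andP[h3 h4]]].
have N0 := pdist_ge0 t' t y' y.
have D : pdist (g t' y') (g t y) (G t' y') (G t y) <= K * pdist t' t y' y.
  have := Ha' _ _ Oy h3; have := Hb' _ _ Oy h4; rewrite /K {3}/pdist mulrDl; lra.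
set N := pdist t' t y' y in N0 h0 D *.
have {}He : `|F (g t' y') (G t' y') - F (g t y) (G t y) -
     lin ft fx (g t' y' - g t y) (G t' y' - G t y)| <= e / 2 * N.
  apply: (@le_trans _ _ (e / 2 / K * (K * N))); last by rewrite mulrA divfK ?gt_eqF.
  apply: le_trans (He _ _ (OP Oy) _) _.
    by apply: le_lt_trans D _; rewrite mulrC -ltr_pdivlMr.
  by rewrite ler_wpM2l// ltW// divr_gt0.
rewrite lin_comp.
(* The remainder of the composite is the remainder of [F] plus the differential of [F] applied to
   the remainders of [g] and [G]. *)
rewrite -[F _ _ - F _ _](subrK (lin ft fx (g t' y' - g t y) (G t' y' - G t y))) -addrA.
rewrite -lin_argB (le_trans (ler_normD _ _))// [e in e * N](splitr e) mulrDl lerD//.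
rewrite (le_trans (lin_bound _ _ _ _))//.
have := Ha _ _ Oy h1; have := Hb _ _ Oy h2; rewrite -/N => B A.
apply: (@le_trans _ _ (L * (e / 4 / (L + 1) * N + e / 4 / (L + 1) * N))).
  by rewrite ler_wpM2l// lerD.
have := divr_succ_mul_le e4 L0 => /(ler_wpM2r N0); rewrite -mulrA; lra.
Qed.

End Composition.
End Frechet.

(** * Uniformly bounded C^k families *)

Section Class.
Context {R : realType}.

(* Families c |-> F c that are k times differentiable relative to O c, with
   derivatives of order up to k continuous and bounded uniformly in c.  Curves are
   the case m = 0. *)
Fixpoint Cb {C : Type} {m : nat} {V : normedModType R} (O : C -> R -> 'cV[R]_m -> Prop)
    (k : nat) (F : C -> R -> 'cV[R]_m -> V) {struct k} : Prop :=
  (exists M, forall c t y, O c t y -> `|F c t y| <= M) /\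
  if k is k'.+1 then
    exists Ft : C -> R -> 'cV[R]_m -> V, exists Fx : 'I_m -> C -> R -> 'cV[R]_m -> V,
    [/\ forall c t y, O c t y ->
          frechet (O c) (F c) t y (Ft c t y) (fun i => Fx i c t y),
        Cb O k' Ft & forall i, Cb O k' (Fx i)]
  else forall c t y, O c t y -> cont_at (O c) (F c) t y.

Lemma CbS {C m} {V : normedModType R} (O : C -> R -> 'cV[R]_m -> Prop) k F :
  Cb (V := V) O k.+1 F <->
  (exists M, forall c t y, O c t y -> `|F c t y| <= M) /\
  exists Ft Fx, [/\ forall c t y, O c t y ->
        frechet (O c) (F c) t y (Ft c t y) (fun i => Fx i c t y),
      Cb O k Ft & forall i, Cb O k (Fx i)].
Proof. by []. Qed.

Section Basics.
Context {C : Type} {m : nat} {V : normedModType R}.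
Variable O : C -> R -> 'cV[R]_m -> Prop.
Implicit Types F G : C -> R -> 'cV[R]_m -> V.

Lemma Cb_bound k F : Cb O k F ->
  exists2 M, 0 < M & forall c t y, O c t y -> `|F c t y| <= M.
Proof.
move=> H; have [M HM] : exists M, forall c t y, O c t y -> `|F c t y| <= M.
  by case: k H => [|k] [].
exists (`|M| + 1) => [|c t y Oc]; first by rewrite ltr_wpDl.
rewrite (le_trans (HM _ _ _ Oc))//; have := ler_norm M; lra.
Qed.

Lemma Cb_cont k F : Cb O k F -> forall c t y, O c t y -> cont_at (O c) (F c) t y.
Proof.
case: k => [|k] [_] // [Ft [Fx [H _ _]]] c t y /H; exact: frechet_cont.
Qed.

Lemma CbW k F : Cb O k.+1 F -> Cb O k F.
Proof.
elim: k F => [|k IH] F HF.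
  by split; [have [M _] := Cb_bound HF; exists M|exact: Cb_cont HF].
case/CbS: HF => HM [Ft [Fx [H Ht Hx]]]; apply/CbS; split=> //.
by exists Ft, Fx; split=> // [|i]; apply: IH.
Qed.

Lemma Cb_le k l F : (k <= l)%N -> Cb O l F -> Cb O k F.
Proof.
by move=> /subnK <-; elim: (l - k)%N => // n IH H; apply/IH/CbW.
Qed.

Lemma Cb_ext k F G : (forall c t y, O c t y -> F c t y = G c t y) ->
  Cb O k F -> Cb O k G.
Proof.
move=> FG; have bG : (exists M, forall c t y, O c t y -> `|F c t y| <= M) ->
    exists M, forall c t y, O c t y -> `|G c t y| <= M.
  by move=> [M HM]; exists M => c t y Oc; rewrite -FG//; exact: HM.
case: k => [[/bG bG' H]|k /CbS[/bG bG' [Ft [Fx [H Ht Hx]]]]].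
  by split=> // c t y Oc; apply: cont_at_ext (H _ _ _ Oc) => //; exact: FG.
apply/CbS; split=> //; exists Ft, Fx; split=> // c t y Oc.
by apply: frechet_ext (H _ _ _ Oc) => //; exact: FG.
Qed.

Lemma Cb_cst k (a : C -> V) M : (forall c t y, O c t y -> `|a c| <= M) ->
  Cb O k (fun c _ _ => a c).
Proof.
elim: k a M => [|k IH] a M HM; (try apply/CbS; split; first by exists M).
  by move=> c t y Oc e e0; exists 1 => // *; rewrite subrr normr0.
have C0 : Cb O k (fun _ _ _ => 0 : V) by apply: (IH _ 0) => *; rewrite normr0.
exists (fun _ _ _ => 0), (fun _ _ _ _ => 0); split=> //.
by move=> c t y Oc; exact: frechet_cst.
Qed.

Lemma CbD k F G : Cb O k F -> Cb O k G -> Cb O k (fun c t y => F c t y + G c t y).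
Proof.
elim: k F G => [|k IH] F G HF HG.
  have [M _ HM] := Cb_bound HF; have [N _ HN] := Cb_bound HG; split.
    exists (M + N) => c t y Oc; rewrite (le_trans (ler_normD _ _))//.
    by rewrite lerD ?HM ?HN.
  move=> c t y Oc; apply: cont_atD; [exact: Cb_cont HF _ _ _ Oc|exact: Cb_cont HG _ _ _ Oc].
have [M _ HM] := Cb_bound HF; have [N _ HN] := Cb_bound HG; apply/CbS; split.
  exists (M + N) => c t y Oc; rewrite (le_trans (ler_normD _ _))//.
  by rewrite lerD ?HM ?HN.
case/CbS: HF => _ [Ft [Fx [HF Ht Hx]]]; case/CbS: HG => _ [Gt [Gx [HG Gt' Gx']]].
exists (fun c t y => Ft c t y + Gt c t y), (fun i c t y => Fx i c t y + Gx i c t y).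
split=> [c t y Oc||i]; [exact: frechetD (HF _ _ _ Oc) (HG _ _ _ Oc)|by apply: IH|by apply: IH].
Qed.

Lemma Cb_sum k (I : Type) (r : seq I) (P : pred I) (F : I -> C -> R -> 'cV[R]_m -> V) :
  (forall i, P i -> Cb O k (F i)) -> Cb O k (fun c t y => \sum_(i <- r | P i) F i c t y).
Proof.
move=> H; elim: r => [|i r IH].
  apply: (Cb_ext (F := fun _ _ _ => 0)) => [c t y _|]; first by rewrite big_nil.
  by apply: (Cb_cst _ (M := 0)) => *; rewrite normr0.
have [Pi|Pi] := boolP (P i); last first.
  by apply: Cb_ext IH => c t y _; rewrite big_cons (negbTE Pi).
by apply: Cb_ext (CbD (H i Pi) IH) => c t y _; rewrite big_cons Pi.
Qed.

End Basics.

Section Scaling.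
Context {C : Type} {m : nat} {V : normedModType R}.
Variable O : C -> R -> 'cV[R]_m -> Prop.
Implicit Types F G : C -> R -> 'cV[R]_m -> V.

Lemma CbZ k (a : C -> R -> 'cV[R]_m -> R) G :
  Cb O k a -> Cb O k G -> Cb O k (fun c t y => a c t y *: G c t y).
Proof.
elim: k a G => [|k IH] a G Ha HG;
  have [M M0 HM] := Cb_bound Ha; have [N N0 HN] := Cb_bound HG; (try apply/CbS; split;
  first by exists (M * N) => c t y Oc; rewrite normrZ; apply: ler_pM (HM _ _ _ Oc) (HN _ _ _ Oc)).
  move=> c t y Oc; apply: cont_atZ; [exact: Cb_cont Ha _ _ _ Oc|exact: Cb_cont HG _ _ _ Oc].
have a' := CbW Ha; have G' := CbW HG.
case/CbS: Ha => _ [at_ [ax [Ha Hat Hax]]]; case/CbS: HG => _ [Gt [Gx [HG HGt HGx]]].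
exists (fun c t y => at_ c t y *: G c t y + a c t y *: Gt c t y).
exists (fun i c t y => ax i c t y *: G c t y + a c t y *: Gx i c t y).
split=> [c t y Oc||i]; last 2 first.
- by apply: CbD; apply: IH.
- by apply: CbD; apply: IH.
exact: frechetZ (Ha _ _ _ Oc) (HG _ _ _ Oc).
Qed.

Lemma Cb_scale k (a : R) G : Cb O k G -> Cb O k (fun c t y => a *: G c t y).
Proof.
move=> HG; apply: (CbZ (a := fun _ _ _ => a)) => //.
exact: (Cb_cst _ (a := fun=> a : R) (M := `|a|)).
Qed.

Lemma CbB k F G : Cb O k F -> Cb O k G -> Cb O k (fun c t y => F c t y - G c t y).
Proof.
move=> HF /(Cb_scale (-1)) HG.
by apply: Cb_ext (CbD HF HG) => c t y _; rewrite scaleN1r.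
Qed.

End Scaling.

Lemma Cb_entry {C m n} (O : C -> R -> 'cV[R]_m -> Prop) k
    (F : C -> R -> 'cV[R]_m -> 'cV[R]_n) (i : 'I_n) :
  Cb O k F -> Cb O k (fun c t y => F c t y i 0).
Proof.
elim: k F => [|k IH] F HF; have [M M0 HM] := Cb_bound HF; (try apply/CbS; split;
  first by exists M => c t y Oc; rewrite (le_trans (mx_norm_ge _ _ _)) ?HM).
  move=> c t y Oc e e0; have [eta eta0 He] := Cb_cont HF Oc e0.
  exists eta => // t' y' Oc' N; apply: le_lt_trans (He _ _ Oc' N).
  by have := mx_norm_ge (F c t' y' - F c t y) i 0; rewrite !mxE.
case/CbS: HF => _ [Ft [Fx [HF Ht Hx]]].
exists (fun c t y => Ft c t y i 0), (fun j c t y => Fx j c t y i 0).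
split=> [c t y Oc||j]; [|exact: IH|exact: IH].
move=> e e0; have [eta eta0 He] := HF _ _ _ Oc _ e0.
exists eta => // t' y' Oc' N; apply: le_trans (He _ _ Oc' N).
have := mx_norm_ge (F c t' y' - F c t y - lin (Ft c t y) (fun j => Fx j c t y) (t' - t) (y' - y)) i 0.
apply: le_trans; rewrite le_eqVlt; apply/orP; left; apply/eqP; congr (`|_|).
rewrite !mxE summxE; congr (_ - (_ + _)).
by apply: eq_bigr => j _; rewrite !mxE.
Qed.

Lemma Cb_mulmx {C m n p} (O : C -> R -> 'cV[R]_m -> Prop) k (A : C -> 'M[R]_(n, p)) M
    (F : C -> R -> 'cV[R]_m -> 'cV[R]_p) :
  (forall c t y, O c t y -> `|A c| <= M) ->
  Cb O k F -> Cb O k (fun c t y => A c *m F c t y).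
Proof.
move=> HA HF; apply: (Cb_ext (F := fun c t y => \sum_i F c t y i 0 *: col i (A c))).
  by move=> c t y _; rewrite mulmx_sum_col.
apply: Cb_sum => i _; apply: CbZ; first exact: Cb_entry.
apply: (Cb_cst _ (M := M)) => c t y Oc; apply: le_trans (HA _ _ _ Oc).
by apply: mx_norm_le => // j l; rewrite mxE mx_norm_ge.
Qed.

Lemma Cb_time {C m} (O : C -> R -> 'cV[R]_m -> Prop) k M :
  (forall c t y, O c t y -> `|t| <= M) -> Cb O k (fun _ t _ => t).
Proof.
move=> HM; apply: CbW; apply/CbS; split; first by exists M.
exists (fun _ _ _ => 1), (fun _ _ _ _ => 0); split=> [c t y Oc e e0||i].
- exists 1 => // t' y' _ _; rewrite /lin big1 => [|i _]; last by rewrite scaler0.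
  rewrite addr0 (_ : (t' - t) *: (1 : R) = t' - t) ?subrr ?normr0.
    by rewrite mulr_ge0 ?pdist_ge0 ?ltW.
  exact: mulr1.
- by apply: (Cb_cst _ (a := fun=> 1 : R) (M := 1)) => *; rewrite normr1.
- by apply: (Cb_cst _ (a := fun=> 0 : R) (M := 0)) => *; rewrite normr0.
Qed.

Lemma Cb_space {C m} (O : C -> R -> 'cV[R]_m -> Prop) k M :
  (forall c t y, O c t y -> `|y| <= M) -> Cb O k (fun _ _ y => y).
Proof.
move=> HM; apply: CbW; apply/CbS; split; first by exists M.
exists (fun _ _ _ => 0), (fun i _ _ _ => delta_mx i 0); split=> [c t y Oc e e0||i].
- exists 1 => // t' y' _ _; rewrite /lin scaler0 add0r -cV_sum_delta subrr normr0.
  by rewrite mulr_ge0 ?pdist_ge0 ?ltW.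
- by apply: (Cb_cst _ (a := fun=> 0) (M := 0)) => *; rewrite normr0.
- exact: (Cb_cst _ (a := fun=> delta_mx i 0) (M := `|delta_mx i 0 : 'cV[R]_m|)).
Qed.

(** Each partial derivative of the composite is a sum of products of a derivative of [F] along ([g],
    [G]), covered by induction, and a derivative of [g] or [G]. The map [sg] changes the parameter,
    so that the single field [f], indexed by [unit], can be composed with a whole family. *)
Lemma Cb_comp {C C' m n} {V : normedModType R} (O : C -> R -> 'cV[R]_m -> Prop)
    (P : C' -> R -> 'cV[R]_n -> Prop) (sg : C -> C') k (F : C' -> R -> 'cV[R]_n -> V) g G :
  (forall c t y, O c t y -> P (sg c) (g c t y) (G c t y)) ->
  Cb P k F -> Cb O k g -> Cb O k G ->
  Cb O k (fun c t y => F (sg c) (g c t y) (G c t y)).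
Proof.
move=> OP; elim: k F => [|k IH] F HF Hg HG; have [M M0 HM] := Cb_bound HF;
  (try apply/CbS; split; first by exists M => c t y Oc; apply/HM/OP).
  move=> c t y Oc; apply: (cont_at_comp (P := P (sg c))) => [t' y'|||].
  - exact: OP.
  - exact: Cb_cont Hg _ _ _ Oc.
  - exact: Cb_cont HG _ _ _ Oc.
  - exact: Cb_cont HF _ _ _ (OP _ _ _ Oc).
have g' := CbW Hg; have G' := CbW HG.
case/CbS: HF => _ [Ft [Fx [HF HFt HFx]]].
case/CbS: Hg => _ [gt [gx [Hg Hgt Hgx]]]; case/CbS: HG => _ [Gt [Gx [HG HGt HGx]]].
exists (fun c t y => lin (Ft (sg c) (g c t y) (G c t y))
  (fun i => Fx i (sg c) (g c t y) (G c t y)) (gt c t y) (Gt c t y)).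
exists (fun j c t y => lin (Ft (sg c) (g c t y) (G c t y))
  (fun i => Fx i (sg c) (g c t y) (G c t y)) (gx j c t y) (Gx j c t y)).
split=> [c t y Oc||j].
- apply: (frechet_comp (P := P (sg c)) (g := g c) (G := G c)) (Hg _ _ _ Oc) (HG _ _ _ Oc) _.
    by move=> t' y'; exact: OP.
  exact: HF _ _ _ (OP _ _ _ Oc).
- apply: CbD; first by apply: CbZ => //; apply: IH.
  apply: Cb_sum => i _; apply: CbZ; first exact: Cb_entry.
  by apply: IH.
- apply: CbD; first by apply: CbZ => //; apply: IH.
  apply: Cb_sum => i _; apply: CbZ; first exact: Cb_entry.
  by apply: IH.
Qed.

(** The bootstrap for solutions of differential equations: if the derivative [H] is expressed
    through [G], smoothness of [G] of class [k] gives [H] of class [k] and hence [G] of class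
    [k.+1]. *)
Lemma Cb_curve {C m} {V : normedModType R} (O : C -> R -> 'cV[R]_m -> Prop)
    (B : C -> set R) k M (G H : C -> R -> V) :
  (forall c t y, O c t y -> B c t) ->
  (forall c t y, O c t y -> deriv_on (B c) (G c) t (H c t)) ->
  (forall c t y, O c t y -> `|G c t| <= M) ->
  Cb O k (fun c t _ => H c t) -> Cb O k.+1 (fun c t _ => G c t).
Proof.
move=> OB GH HM HH; apply/CbS; split; first by exists M.
exists (fun c t _ => H c t), (fun _ _ _ _ => 0); split=> [c t y Oc||i] //.
  move=> e e0; have [eta eta0 He] := GH _ _ _ Oc _ e0; exists eta => // t' y' Oc' N.
  have N' : `|t' - t| <= pdist t' t y' y by rewrite lerDl.
  rewrite /lin big1 => [|i _]; last by rewrite scaler0.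
  rewrite addr0; apply: le_trans (He _ (OB _ _ _ Oc') (le_lt_trans N' N)) _.
  by rewrite ler_wpM2l// ltW.
by apply: (Cb_cst _ (a := fun=> 0) (M := 0)) => *; rewrite normr0.
Qed.

Lemma Cb_curve0 {C m} {V : normedModType R} (O : C -> R -> 'cV[R]_m -> Prop)
    (B : C -> set R) M (G H : C -> R -> V) :
  (forall c t y, O c t y -> B c t) ->
  (forall c t y, O c t y -> deriv_on (B c) (G c) t (H c t)) ->
  (forall c t y, O c t y -> `|G c t| <= M) -> Cb O 0 (fun c t _ => G c t).
Proof.
move=> OB GH HM; split; first by exists M.
move=> c t y Oc e e0; have [eta eta0 He] := deriv_on_cont (GH _ _ _ Oc) e0.
exists eta => // t' y' Oc' N; apply: He; first exact: OB _ _ _ Oc'.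
by apply: le_lt_trans N; rewrite lerDl.
Qed.

End Class.

(** * Taylor expansion of C^k families *)

Section Bridge.
Context {R : realType}.

Lemma deriv_onP {V : normedModType R} (A : set R) (g : R -> V) t (l : V) :
  (h^-1 *: (g (t + h) - g t) @[h --> within [set h | A (t + h)] 0^'] --> l) <->
  deriv_on A g t l.
Proof.
have eqn h : h != 0 -> `|l - h^-1 *: (g (t + h) - g t)| = `|h|^-1 * `|g (t + h) - g t - h *: l|.
  move=> h0; rewrite -normfV -normrZ [in RHS]scalerBr scalerA mulVf// scale1r distrC //.
split.
  move=> H e e0; move/cvgrPdist_le: H => /(_ e e0)/nbhs_normP[eta /= eta0 He].
  exists eta => // s As st.
  have [->|sN] := eqVneq s t; first by rewrite !subrr scale0r subrr !normr0 mulr0.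
  have st0 : s - t != 0 by rewrite subr_eq0.
  have := He (s - t); rewrite /= sub0r normrN [t + _]addrC subrK => /(_ st st0 As).
  have := eqn _ st0; rewrite [t + _]addrC subrK => ->.
  by rewrite mulrC ler_pdivrMr// normr_gt0.
move=> H; apply/cvgrPdist_le => e e0.
have [eta eta0 He] := H e e0; apply/nbhs_normP; exists eta => //= h.
rewrite /= sub0r normrN => h1 h0 Ah; rewrite eqn// mulrC ler_pdivrMr ?normr_gt0//.
by have := He _ Ah; rewrite [t + h]addrC addrK => /(_ h1).
Qed.

Lemma is_derive_inP {V : normedModType R} a b (g : R -> V) t (l : V) :
  is_derive_in a b g t l <-> deriv_on [set s | a <= s <= b] g t l.
Proof. exact: deriv_onP. Qed.

Lemma derive_deriv_on {V W : normedModType R} (f : V -> W) (y v : V) (A : set R) r :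
  derivable f (y + r *: v) v ->
  deriv_on A (fun s => f (y + s *: v)) r ('D_v f (y + r *: v)).
Proof.
move=> H; apply: (@deriv_on_sub _ _ _ setT) => //; apply/deriv_onP.
have -> : (fun h => h^-1 *: (f (y + (r + h) *: v) - f (y + r *: v))) =
    (fun h => h^-1 *: (f (h *: v + (y + r *: v)) - f (y + r *: v))).
  by apply/funext => h; rewrite scalerDl addrA [y + _ + _]addrC.
by apply: cvg_trans H; apply: cvg_app; exact: cvg_within.
Qed.

Lemma deriv_on_derive {V W : normedModType R} (f : V -> W) (y v : V) l e :
  0 < e -> deriv_on [set r | `|r| < e] (fun s => f (y + s *: v)) 0 l ->
  derivable f y v /\ 'D_v f y = l.
Proof.
move=> e0 H; suff H' : h^-1 *: (f (h *: v + y) - f y) @[h --> 0^'] --> l.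
  split; first by apply/cvg_ex; exists l.
  exact/cvg_lim.
move/deriv_onP: H; rewrite scale0r addr0 => H.
have {}H : (fun h => h^-1 *: (f (h *: v + y) - f y)) @
    within [set h : R | `|0 + h| < e] 0^' --> l.
  have -> // : (fun h => h^-1 *: (f (h *: v + y) - f y)) =
     (fun h => h^-1 *: (f (y + (0 + h) *: v) - f y)).
  by apply/funext => h; rewrite add0r [h *: v + y]addrC.
apply: cvg_trans H; apply: cvg_app => P; rewrite /nbhs/= /within/= => HP.
near=> h; have he : `|0 + h| < e by rewrite add0r; near: h; apply: dnbhs0_lt.
by move: he; near: h.
Unshelve. all: by end_near. Qed.

Lemma is_derive_deriv_on (A : set R) (f : R -> R) (t l : R) :
  is_derive t 1 f l -> deriv_on A f t l.
Proof.
move=> H; have := @derive_deriv_on _ _ f 0 1 A t.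
have -> : (0 + t *: 1 : R) = t by rewrite add0r; exact: mulr1.
rewrite (@derive_val _ _ _ _ _ _ _ H) => /(_ (@ex_derive _ _ _ _ _ _ _ H)).
by have -> : (fun s => f (0 + s *: 1)) = f by apply/funext => s; congr f; rewrite add0r; exact: mulr1.
Qed.

Lemma deriv_on_scalel {V : normedModType R} (A : set R) (f : R -> R) (t l : R) (v : V) :
  deriv_on A f t l -> deriv_on A (fun s => f s *: v) t (l *: v).
Proof.
move=> H e e0; have v1 : 0 < `|v| + 1 by apply: ltr_wpDl.
have [eta eta0 He] := H _ (divr_gt0 e0 v1); exists eta => // s As st.
rewrite scalerA -!scalerBl normrZ mulrC.
apply: (@le_trans _ _ (`|v| * (e / (`|v| + 1) * `|s - t|))).
  by rewrite ler_wpM2l//; exact: He.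
by rewrite mulrA ler_wpM2r// divr_succ_mul_le.
Qed.

Lemma deriv_on_monomial {V : normedModType R} (A : set R) j t (v : V) :
  deriv_on A (fun s => s ^+ j.+1 *: (j.+1%:R^-1 *: v)) t (t ^+ j *: v).
Proof.
have -> : t ^+ j *: v = (j.+1%:R * t ^+ j) *: (j.+1%:R^-1 *: v).
  by rewrite scalerA mulrAC divff ?mul1r// pnatr_eq0.
apply: deriv_on_scalel; apply: is_derive_deriv_on.
have := @is_deriveX _ _ (@id R) j.+1 t 1 1 (is_derive_id _ _).
have -> : (@id R) ^+ j.+1 = (fun s => s ^+ j.+1) by rewrite exprfctE.
by move=> H; apply: is_derive_eq; exact: mulr1.
Qed.

Lemma deriv_on_sum {V : normedModType R} (A : set R) (I : Type) (r : seq I)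
    (g : I -> R -> V) t (l : I -> V) :
  (forall i, deriv_on A (g i) t (l i)) ->
  deriv_on A (fun s => \sum_(i <- r) g i s) t (\sum_(i <- r) l i).
Proof.
move=> H; elim: r => [|i r IH].
  rewrite big_nil (_ : (fun _ => _) = (fun=> 0)); first exact: deriv_on_cst.
  by apply/funext => s; rewrite big_nil.
rewrite big_cons (_ : (fun _ => _) = (fun s => g i s + \sum_(j <- r) g j s)).
  exact: deriv_onD.
by apply/funext => s; rewrite big_cons.
Qed.

Lemma frechet_deriv_on {m} {V : normedModType R} (O : R -> 'cV[R]_m -> Prop)
    (A : set R) F t y ft (fx : 'I_m -> V) :
  (forall s, A s -> O s y) -> frechet O F t y ft fx -> deriv_on A (fun s => F s y) t ft.
Proof.
move=> AO H e e0; have [eta eta0 He] := H _ e0; exists eta => // s As st.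
have := He _ _ (AO _ As); rewrite /pdist subrr normr0 addr0 => /(_ st).
rewrite /lin big1 ?addr0// => i _; by rewrite mxE scale0r.
Qed.

Section Taylor.
Context {C : Type} {m : nat} {V : normedModType R}.
Variables (O : C -> R -> 'cV[R]_m -> Prop) (h : C -> R).
Hypothesis hO : forall c s, 0 <= s <= h c -> O c s 0.
Implicit Types G : C -> R -> 'cV[R]_m -> V.

(** Expand the time derivative by induction and let [P] be the primitive of its Taylor polynomial.
    The derivative of G - P is the remainder already bounded, so the mean value bound replaces an
    integral remainder, and [M] stays independent of [c]. The coefficients are the divided ones of
    the derivative, shifted by one, below the constant term [G c 0 0]. *)
Lemma Cb_taylor k G : Cb O k G -> exists M (a : nat -> C -> V), 0 <= M /\
  forall c s, 0 <= s <= h c -> `|G c s 0 - \sum_(j < k) s ^+ j *: a j c| <= M * s ^+ k.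
Proof.
elim: k G => [|k IH] G.
  move=> /Cb_bound[M M0 HM]; exists M, (fun _ _ => 0); split; first exact: ltW.
  by move=> c s /hO Oc; rewrite big_ord0 subr0 mulr1 HM.
move=> /CbS[_ [Gt [Gx [HG /IH[M [a [M0 HM]]] _]]]].
exists M, (fun j c => if j is j'.+1 then j%:R^-1 *: a j' c else G c 0 0); split=> // c s /andP[s0 sh].
pose P r : V := \sum_(j < k) r ^+ j.+1 *: (j.+1%:R^-1 *: a j c).
have dP r B : deriv_on B P r (\sum_(j < k) r ^+ j *: a j c).
  by apply: deriv_on_sum => j; exact: deriv_on_monomial.
have P0 : P 0 = 0 by rewrite /P big1// => i _; rewrite expr0n scale0r.
have := @mean_value_bound _ _ (fun r => G c r 0 - P r)
  (fun r => Gt c r 0 - \sum_(j < k) r ^+ j *: a j c) 0 s (M * s ^+ k) s0.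
rewrite P0 !subr0 => H; rewrite big_ord_recl expr0 scale1r.
rewrite opprD addrA addrAC exprSr mulrA; apply: H => r /andP[r0 rs].
  apply: deriv_onB; last exact: dP.
  apply: (frechet_deriv_on (O := O c)) (HG _ _ _ _).
    by move=> x /= /andP[x0 xs]; apply: hO; rewrite x0 (le_trans xs).
  by apply: hO; rewrite r0 (le_trans rs).
apply: (le_trans (HM _ _ _)); first by rewrite r0 (le_trans rs).
by rewrite ler_wpM2l// lerXn2r// nnegrE.
Qed.

(** The constant term is killed by letting s tend to 0; dividing by s then leaves a polynomial with
    one coefficient less and the same kind of bound. *)
Lemma poly_small_coef0 k (a : nat -> V) K d : 0 < d ->
  (forall s, 0 < s < d -> `|\sum_(j < k) s ^+ j *: a j| <= K * s ^+ k) ->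
  forall j, (j < k)%N -> a j = 0.
Proof.
elim: k a => [|k IH] a d0 H j //.
have a0 : a 0%N = 0.
  apply/eqP; rewrite -normr_le0; apply/ler_addgt0Pr => e e0; rewrite add0r.
  pose B := \sum_(j < k) `|a j.+1|.
  have B0 : 0 <= B by apply: sumr_ge0.
  have K1 : 0 < `|K| + B + 1 by rewrite ltr_wpDl// addr_ge0.
  pose s := Num.min (Num.min 1 (d / 2)) (e / (`|K| + B + 1)).
  have s0 : 0 < s by rewrite !lt_min ltr01 !divr_gt0.
  have s1 : s <= 1 by rewrite !ge_min lexx.
  have sd : s < d by rewrite (@le_lt_trans _ _ (d / 2))//; [rewrite !ge_min lexx orbT|lra].
  have se : s * (`|K| + B + 1) <= e by rewrite -ler_pdivlMr// !ge_min lexx !orbT.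
  have := H s; rewrite s0 sd => /(_ isT); rewrite big_ord_recl expr0 scale1r => Hs.
  have tl : `|\sum_(i < k) s ^+ i.+1 *: a i.+1| <= B * s.
    rewrite (le_trans (ler_norm_sum _ _ _))// mulr_suml ler_sum// => i _.
    rewrite normrZ mulrC ler_wpM2l// ger0_norm; last by rewrite exprn_ge0 ?ltW.
    by rewrite exprS ger_pMr// exprn_ile1// ltW.
  have K2 : K * s ^+ k.+1 <= `|K| * s.
    rewrite (le_trans (ler_norm _))// normrM ler_wpM2l// ger0_norm; last by rewrite exprn_ge0 ?ltW.
    by rewrite exprS ger_pMr// exprn_ile1// ltW.
  have := ler_normB (a 0%N + \sum_(i < k) s ^+ i.+1 *: a i.+1) (\sum_(i < k) s ^+ i.+1 *: a i.+1).
  rewrite addrK; move: Hs => /=.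
  rewrite (eq_bigr (fun i : 'I_k => s ^+ i.+1 *: a i.+1))// => Hs.
  move: se; rewrite mulrC !mulrDl; lra.
case: j => [//|j]; rewrite ltnS => jk.
apply: (IH (fun j => a j.+1)) jk => // s /[dup] sd /H; rewrite big_ord_recl a0 scaler0 add0r.
have s0 : 0 < s by case/andP: sd.
rewrite (eq_bigr (fun i : 'I_k => s *: (s ^+ i *: a i.+1))); last first.
  by move=> i _; rewrite scalerA -exprS.
by rewrite -scaler_sumr normrZ gtr0_norm// exprS mulrCA ler_pM2l.
Qed.

(* The pointwise hypothesis has constants depending on c; it only serves to kill the
   Taylor coefficients of order less than k, after which the remainder is uniform. *)
Lemma Cb_flat k G : Cb O k G ->
  (forall c, 0 < h c -> exists K d, 0 < d /\ forall s, 0 < s < d -> s <= h c -> `|G c s 0| <= K * s ^+ k) ->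
  exists M, 0 <= M /\ forall c s, 0 < s <= h c -> `|G c s 0| <= M * s ^+ k.
Proof.
move=> /Cb_taylor[M [a [M0 HM]]] H; exists M; split=> // c s /andP[s0 sh].
have h0 : 0 < h c by apply: lt_le_trans sh.
have [K [d [d0 Hd]]] := H c h0.
have A : forall j, (j < k)%N -> a j c = 0.
  apply: (@poly_small_coef0 k (fun j => a j c) (K + M) (Num.min d (h c))); first by rewrite lt_min d0.
  move=> r /andP[r0]; rewrite lt_min => /andP[rd rh].
  have := ler_normB (G c r 0) (G c r 0 - \sum_(j < k) r ^+ j *: a j c).
  rewrite subKr mulrDl => /le_trans; apply; apply: lerD.
    by apply: Hd; [rewrite r0 rd|exact: ltW].
  by apply: HM; rewrite !ltW.
have := HM c s; rewrite sh ltW// => /(_ isT).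
by rewrite big1 ?subr0// => i _; rewrite A// scaler0.
Qed.

End Taylor.

End Bridge.

(** * Matrix exponential and the linear flow *)

Section EntireSeries.
Context {R : realType}.
Implicit Types (c : R^nat).

(** Differentiating a power series requires convergence of its first two formal derivatives; this
    domination is preserved by [pseries_diffs] and gives convergence everywhere. *)
Definition exp_dominated c := exists B L : R,
  [/\ 0 <= B, 0 <= L & forall k, `|c k| <= B * (L ^+ k / k`!%:R)].

Lemma exp_dominated_cvg c x : exp_dominated c -> cvgn (pseries c x).
Proof.
move=> [B [L [B0 L0 cB]]]; apply: normed_cvg.
apply: (@series_le_cvg _ (fun k => `|c k * x ^+ k|) (fun k => B * exp_coeff (L * `|x|) k)).
- by move=> k; exact: normr_ge0.
- by move=> k; rewrite mulr_ge0// divr_ge0// exprn_ge0// mulr_ge0.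
- move=> k; rewrite normrM normrX /exp_coeff/= exprMn mulrAC mulrA.
  by rewrite ler_wpM2r// exprn_ge0.
exact: is_cvg_seriesZ (is_cvg_series_exp_coeff _).
Qed.

Lemma exp_dominated_diffs c : exp_dominated c -> exp_dominated (pseries_diffs c).
Proof.
move=> [B [L [B0 L0 cB]]]; exists (B * L), L; split=> [||k] //.
  by rewrite mulr_ge0.
rewrite /pseries_diffs normrM ger0_norm//.
apply: le_trans (ler_wpM2l _ (cB k.+1)) _ => //.
have k0 : k`!%:R != 0 :> R by rewrite pnatr_eq0 -lt0n fact_gt0.
have k1 : k.+1%:R != 0 :> R by rewrite pnatr_eq0.
rewrite factS natrM exprS le_eqVlt; apply/orP; left; apply/eqP.
by move: k1 k0; move: (k.+1%:R) (k`!%:R) => a b a0 b0; field; rewrite a0 b0.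
Qed.

Lemma is_derive_entire c (x : R) : exp_dominated c ->
  is_derive x 1 (fun x => limn (pseries c x)) (limn (pseries (pseries_diffs c) x)).
Proof.
move=> cd; apply: (@pseries_snd_diffs _ _ (`|x| + 1)).
- exact: exp_dominated_cvg.
- exact/exp_dominated_cvg/exp_dominated_diffs.
- exact/exp_dominated_cvg/exp_dominated_diffs/exp_dominated_diffs.
- by rewrite [ltRHS]ger0_norm ?addr_ge0// ltrDl.
Qed.

Lemma pseries_cvgD c c' x l l' : pseries c x @ \oo --> l -> pseries c' x @ \oo --> l' ->
  pseries (fun k => c k + c' k) x @ \oo --> l + l'.
Proof.
move=> H H'; have -> : pseries (fun k => c k + c' k) x = pseries c x \+ pseries c' x.
  apply/funext => n; rewrite /pseries /series /= -big_split.
  by apply: eq_bigr => i _; rewrite mulrDl.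
exact: cvgD.
Qed.

Lemma pseries_cvgZ a c x l : pseries c x @ \oo --> l ->
  pseries (fun k => a * c k) x @ \oo --> a * l.
Proof.
move=> H; have -> : pseries (fun k => a * c k) x = (fun n => a * pseries c x n).
  apply/funext => n; rewrite /pseries /series /= mulr_sumr.
  by apply: eq_bigr => i _; rewrite mulrA.
by apply: cvgMr.
Qed.

Lemma pseries_cvg_monomial (a x : R) n :
  pseries (fun k => if k == n then a else 0) x @ \oo --> a * x ^+ n.
Proof.
apply/cvgrPdist_le => e e0; near=> N; have nN : (n < N)%N by near: N; exact: nbhs_infty_gt.
rewrite /pseries /series /= (big_mkord xpredT) (bigD1 (Ordinal nN))//= eqxx big1.
  by rewrite addr0 subrr normr0 ltW.
by move=> i; rewrite -val_eqE /= => /negbTE ->; rewrite mul0r.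
Unshelve. all: by end_near. Qed.

Lemma pseries_cvg_sum n (a : 'I_n -> R) (c : 'I_n -> R^nat) x (l : 'I_n -> R) :
  (forall i, pseries (c i) x @ \oo --> l i) ->
  pseries (fun k => \sum_i a i * c i k) x @ \oo --> \sum_i a i * l i.
Proof.
move=> H; elim: n a c l H => [|n IH] a c l H.
  rewrite big_ord0 (_ : (fun k => _) = (fun k => if k == 0%N then 0 else 0)).
    by have := @pseries_cvg_monomial 0 x 0; rewrite mul0r.
  by apply/funext => k; rewrite big_ord0 if_same.
rewrite big_ord_recr (_ : (fun k => _) = (fun k =>
  \sum_(i < n) a (widen_ord (leqnSn n) i) * c (widen_ord (leqnSn n) i) k + a ord_max * c ord_max k)).
  apply: pseries_cvgD; last exact: pseries_cvgZ.
  by apply: (IH (fun i => a (widen_ord (leqnSn n) i)) (fun i => c (widen_ord (leqnSn n) i))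
    (fun i => l (widen_ord (leqnSn n) i))).
by apply/funext => k; rewrite big_ord_recr.
Qed.

End EntireSeries.

Section MatrixExponential.
Context {R : realType} {d : nat}.
Variable A : 'M[R]_d.

(* Coefficients of the n-fold iterated primitive of exp(sA), vanishing at 0 to order n. *)
Definition mexp_coef n (i j : 'I_d) : R^nat :=
  fun k => if (k < n)%N then 0 else (A ^+ (k - n)) i j / k`!%:R.

Definition mexp_prim n (s : R) : 'M[R]_d :=
  \matrix_(i, j) limn (pseries (mexp_coef n i j) s).

Lemma mx_norm_expr k : `|A ^+ k| <= (d%:R * `|A| + 1) ^+ k.
Proof.
elim: k => [|k IH].
  rewrite !expr0; apply: mx_norm_le => // i j; rewrite mxE.
  by case: (i == j); rewrite ?normr1 ?normr0.
rewrite !exprS (le_trans (mx_norm_mulmx _ _))// ler_pM ?mulr_ge0//.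
by rewrite lerDl.
Qed.

Lemma mexp_coef_dominated n i j : exp_dominated (mexp_coef n i j).
Proof.
exists 1, (d%:R * `|A| + 1); have L0 : 0 <= d%:R * `|A| by rewrite mulr_ge0.
split=> [||k]; [by []|lra|]; rewrite mul1r /mexp_coef; case: ltnP => nk.
  by rewrite normr0 divr_ge0// exprn_ge0//; lra.
rewrite normrM [`|_^-1|]ger0_norm ?invr_ge0// ler_wpM2r ?invr_ge0//.
rewrite (le_trans (mx_norm_ge _ _ _))// (le_trans (mx_norm_expr _))//.
by rewrite ler_weXn2l ?leq_subr//; lra.
Qed.

Lemma mexp_coef_diffs n i j : pseries_diffs (mexp_coef n.+1 i j) = mexp_coef n i j.
Proof.
apply/funext => k; rewrite /pseries_diffs /mexp_coef ltnS subSS.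
case: ltnP => _; first by rewrite mulr0.
by rewrite factS natrM invfM mulrCA mulVKf// pnatr_eq0.
Qed.

Lemma mexp_prim_cvg n i j s : pseries (mexp_coef n i j) s @ \oo --> mexp_prim n s i j.
Proof. by rewrite mxE; exact/exp_dominated_cvg/mexp_coef_dominated. Qed.

Lemma is_derive_mexp_prim n i j (s : R) :
  is_derive s 1 (fun s => mexp_prim n.+1 s i j) (mexp_prim n s i j).
Proof.
rewrite (_ : (fun s => _) = (fun s => limn (pseries (mexp_coef n.+1 i j) s))).
  by rewrite mxE -(mexp_coef_diffs n); exact/is_derive_entire/mexp_coef_dominated.
by apply/funext => x; rewrite mxE.
Qed.

Lemma derivable_mexp_prim n i j (s : R) : derivable (fun s => mexp_prim n s i j) s 1.
Proof.
rewrite (_ : (fun s => _) = (fun s => limn (pseries (mexp_coef n i j) s))).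
  exact: (@ex_derive _ _ _ _ _ _ _ (is_derive_entire s (mexp_coef_dominated n i j))).
by apply/funext => x; rewrite mxE.
Qed.

(** On coefficients this is a shift: beyond k = n one factor [A] splits off, and k = n leaves the
    identity matrix. Together with [is_derive_mexp_prim] it is the linear equation E' = A E + s^n /
    n! solved by the primitive of index [n.+1]. *)
Lemma mexp_primS n s : (mexp_prim n s = A *m mexp_prim n.+1 s + (s ^+ n / n`!%:R)%:M).
Proof.
apply/matrixP => i j; rewrite !mxE.
have H : pseries (fun k => \sum_l A i l * mexp_coef n.+1 l j k +
    (if k == n then (i == j)%:R / n`!%:R else 0)) s @ \oo -->
    \sum_l A i l * mexp_prim n.+1 s l j + (i == j)%:R / n`!%:R * s ^+ n.
  apply: pseries_cvgD; last exact: pseries_cvg_monomial.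
  by apply: pseries_cvg_sum => l; exact: mexp_prim_cvg.
rewrite (_ : mexp_coef n i j = (fun k => \sum_l A i l * mexp_coef n.+1 l j k +
    (if k == n then (i == j)%:R / n`!%:R else 0))).
  rewrite (cvg_lim _ H)//; congr (_ + _).
  by case: (i == j); rewrite ?mul0r// mul1r mulrC.
apply/funext => k; rewrite /mexp_coef ltnS; case: ltngtP => [kn|kn|->].
- by rewrite addr0 big1// => l _; rewrite mulr0.
- rewrite addr0 -(subnSK kn) exprS mxE mulr_suml.
  by apply: eq_bigr => l _; rewrite mulrA.
- by rewrite subnn expr0 big1 ?add0r ?mxE// => l _; rewrite mulr0.
Qed.

Lemma mexp_prim0 n : mexp_prim n.+1 0 = 0.
Proof.
apply/matrixP => i j; rewrite [RHS]mxE mxE; apply: cvg_lim => //.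
have := @pseries_cvg_monomial R 0 0 0; rewrite mul0r.
have -> // : pseries (fun k => if k == 0%N then 0 else 0) 0 =
    pseries (mexp_coef n.+1 i j) 0.
apply/funext => N; rewrite /pseries /series /=; apply: eq_bigr => -[|k] _.
  by rewrite eqxx /mexp_coef.
by rewrite /= mul0r expr0n mulr0.
Qed.

Lemma scalemx_expr (s : R) k : (s *: A) ^+ k = s ^+ k *: A ^+ k.
Proof.
elim: k => [|k IH]; first by rewrite !expr0 scale1r.
rewrite !exprS IH; apply: etrans (esym (scalemxAl _ _ _)) _.
by rewrite -scalerA; congr (_ *: _); exact: esym (scalemxAr _ _ _).
Qed.

(** The limit of matrices is identified entry by entry; as there are finitely many entries, their
    convergence is uniform, which is convergence in the maximum norm. *)
Lemma mexp_scale s : mexp (s *: A) = mexp_prim 0 s.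
Proof.
apply: cvg_lim => //; apply/cvgrPdist_le => e e0.
have H : \forall n \near \oo, forall i j,
    `|mexp_prim 0 s i j - pseries (mexp_coef 0 i j) s n| <= e.
  apply: filter_forall => i; apply: filter_forall => j.
  by move/cvgrPdist_le: (@mexp_prim_cvg 0 i j s); exact.
move: H; apply: filterS => n H; apply: mx_norm_le => [|i j]; first exact: ltW.
rewrite mxE [X in _ + X]mxE.
have -> : series (fun k => k`!%:R^-1 *: (s *: A) ^+ k) n i j =
    pseries (mexp_coef 0 i j) s n; last exact: H.
rewrite /pseries /series /= summxE; apply: eq_bigr => k _.
by rewrite scalemx_expr scalerA mxE /mexp_coef subn0 mulrC mulrA.
Qed.

End MatrixExponential.

(** * Oriented integrals and the closed form of the linear flow *)

Section OrientedIntegral.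
Context {R : realType}.

Lemma oriented_integral_FTC (f F : R -> R) (x : R) :
  (forall u : R, is_derive u 1 F (f u)) -> (forall u : R, derivable f u 1) ->
  (if 0 <= x then \int[lebesgue_measure]_(u in `[0, x]) f u
   else - \int[lebesgue_measure]_(u in `[x, 0]) f u) = F x - F 0.
Proof.
move=> dF df.
have cf : continuous f by move=> u; exact/differentiable_continuous/derivable1_diffP.
have cF : continuous F.
  by move=> u; apply/differentiable_continuous/derivable1_diffP/ex_derive.
have FTC a b : a < b -> \int[lebesgue_measure]_(u in `[a, b]) f u = F b - F a.
  move=> ab; rewrite /Rintegral (@continuous_FTC2 _ f F a b)//.
  - exact: continuous_subspaceT.
  - split=> [u _||]; first exact: ex_derive.
    + exact/cvg_at_right_filter/cF.
    + exact/cvg_at_left_filter/cF.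
  - by move=> u _; rewrite derive1E; exact: derive_val.
case: ltgtP => [x0|x0|<-]; [exact: FTC|by rewrite FTC// opprB|].
by rewrite set_itv1 Rintegral_set1 subrr.
Qed.

Lemma uniform_eta n (P : 'I_n -> R -> Prop) :
  (forall i x y, x <= y -> P i y -> P i x) -> (forall i, exists2 x, 0 < x & P i x) ->
  exists2 x, 0 < x & forall i, P i x.
Proof.
move=> mono H; have H' i : exists x, 0 < x /\ P i x by have [x] := H i; exists x.
have [g Hg] := choice H'; exists (\big[Num.min/1]_i g i) => [|i].
  by elim/big_ind: _ => // [x y x0 y0|i _]; [rewrite lt_min x0|case: (Hg i)].
apply: (mono _ _ (g i)); last by case: (Hg i).
exact: bigmin_le_cond.
Qed.

Lemma deriv_on_cV n (B : set R) (g : R -> 'cV[R]_n) t (l : 'cV[R]_n) :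
  (forall i, deriv_on B (fun s => g s i 0 : R) t (l i 0)) -> deriv_on B g t l.
Proof.
move=> H e e0; have [||eta eta0 He] := @uniform_eta n (fun i eta => forall s, B s ->
    `|s - t| < eta -> `|g s i 0 - g t i 0 - (s - t) * l i 0| <= e * `|s - t|).
- by move=> i x y xy Hy s Bs sx; apply: Hy => //; exact: lt_le_trans xy.
- by move=> i; have [eta eta0 He] := H i e e0; exists eta.
exists eta => // s Bs st; apply: mx_norm_le => [|i j].
  by rewrite mulr_ge0// ltW.
by rewrite !mxE ord1; exact: He.
Qed.

End OrientedIntegral.

Section AffineDerive.
Context {R : realType}.

Lemma is_derive_affine (a b u : R) : is_derive u 1 (fun u => a + u * b) b.
Proof.
by apply: is_derive_eq; rewrite add0r mul1r scaler0 add0r; exact: mulr1.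
Qed.

(** Here [e0], [e1], [e2] stand for entries of the iterated primitives at x - u, whence the minus
    signs; the two terms [e1 u * b] of the product rule cancel. *)
Lemma affine_convolution_derive (e0 e1 e2 : R -> R) (a b u : R) :
  is_derive u 1 e1 (- e0 u) -> is_derive u 1 e2 (- e1 u) ->
  is_derive u 1 (fun u => e1 u * (a + u * b) + e2 u * b) (- (e0 u * (a + u * b))).
Proof.
move=> H1 H2.
have H : is_derive u 1 ((e1 * (fun u => a + u * b)) + (e2 * cst b))
   ((e1 u *: b + (a + u * b) *: (- e0 u)) + (e2 u *: 0 + b *: (- e1 u))).
  apply: is_deriveD; apply: is_deriveM => //; exact: is_derive_affine.
by apply: (@is_derive_eq _ _ _ _ _ _ _ _ H); rewrite /GRing.scale /=; ring.
Qed.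

End AffineDerive.

Section LinearFlow.
Context {R : realType} {d : nat}.
Variables (A : 'M[R]_d) (al be : 'cV[R]_d).

Definition linear_flow (x : R) : 'cV[R]_d :=
  oriented_integral (fun u => mexp ((x - u) *: A) *m (al + u *: be)) x.

(* An antiderivative of the integrand, up to sign, is
   E1(x - u)(al + u be) + E2(x - u) be, where E1, E2 are the iterated primitives of exp(uA). *)
Lemma linear_flowE x : linear_flow x = mexp_prim A 1 x *m al + mexp_prim A 2 x *m be.
Proof.
have dsub (u : R) : is_derive u 1 (fun u => x - u) (-1 : R).
  by apply: is_derive_eq; rewrite add0r mul1r.
have dE n i j (u : R) : is_derive u 1 (fun u => mexp_prim A n.+1 (x - u) i j) (- mexp_prim A n (x - u) i j).
  have := @is_derive1_comp _ (fun s => mexp_prim A n.+1 s i j) (fun u => x - u) u _ _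
    (is_derive_mexp_prim A n i j (x - u)) (dsub u).
  by rewrite mulrN1.
have ddE n i j (u : R) : derivable (fun u => mexp_prim A n (x - u) i j) u 1.
  have /derivableP H := @derivable_mexp_prim _ _ A n i j (x - u).
  exact: (@ex_derive _ _ _ _ _ _ _ 
    (@is_derive1_comp _ (fun s => mexp_prim A n s i j) (fun u => x - u) u _ _ H (dsub u))).
pose P i j u := mexp_prim A 1 (x - u) i j * (al j 0 + u * be j 0)
  + mexp_prim A 2 (x - u) i j * be j 0.
pose p i j u := mexp_prim A 0 (x - u) i j * (al j 0 + u * be j 0).
have dP i j (u : R) : is_derive u 1 (P i j) (- p i j u).
  exact: (@affine_convolution_derive _ (fun u => mexp_prim A 0 (x - u) i j)
    (fun u => mexp_prim A 1 (x - u) i j) (fun u => mexp_prim A 2 (x - u) i j) _ _ u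
    (dE 0%N i j u) (dE 1%N i j u)).
have dp i j (u : R) : derivable (p i j) u 1.
  have H := derivableM (ddE 0%N i j u)
    (@ex_derive _ _ _ _ _ _ _ (is_derive_affine (al j 0) (be j 0) u)).
  exact: H.
apply/colP => i; rewrite /linear_flow /oriented_integral mxE.
pose F := - \sum_j P i j; pose f := \sum_j p i j.
have dF (u : R) : is_derive u 1 F (f u).
  have -> : f u = - \sum_j - p i j u.
    rewrite -sumrN /f fct_sumE; by apply: eq_bigr => j _; rewrite opprK.
  apply: is_deriveN; exact: is_derive_sum.
have df (u : R) : derivable f u 1 by apply: derivable_sum.
have fE u : (mexp ((x - u) *: A) *m (al + u *: be)) i 0 = f u.
  rewrite mexp_scale mxE /f fct_sumE; apply: eq_bigr => j _.
  by rewrite [in RHS]/p !mxE.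
have -> : (fun u => (mexp ((x - u) *: A) *m (al + u *: be)) i 0) = f by apply/funext => v; exact: fE.
rewrite (oriented_integral_FTC _ dF df).
have FE u : F u = - \sum_j P i j u by rewrite /F fct_sumE.
(* At u = x the primitives are evaluated at 0 and vanish; only the end point u = 0 contributes. *)
rewrite !FE opprK big1 => [|j _]; last by rewrite /P subrr !mexp_prim0 !mxE !mul0r addr0.
rewrite oppr0 add0r mxE [X in X + _]mxE [X in _ + X]mxE -big_split; apply: eq_bigr => j _.
by rewrite /P subr0 mul0r addr0.
Qed.

Lemma deriv_mexp_prim_mul B n (v : 'cV[R]_d) x :
  deriv_on B (fun s => mexp_prim A n.+1 s *m v) x (mexp_prim A n x *m v).
Proof.
apply: deriv_on_cV => i.
have -> : (fun s => (mexp_prim A n.+1 s *m v) i 0) = (fun s => \sum_j mexp_prim A n.+1 s i j *: v j 0).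
  by apply/funext => s; rewrite mxE.
have -> : (mexp_prim A n x *m v) i 0 = \sum_j mexp_prim A n x i j *: v j 0 by rewrite mxE.
apply: deriv_on_sum => j; apply: deriv_on_scalel; apply: is_derive_deriv_on.
exact: is_derive_mexp_prim.
Qed.

(** Differentiating the closed form lowers both indices of the primitives, and [mexp_primS] at 0 and
    at 1 turns the result back into the flow. *)
Lemma deriv_linear_flow B x : deriv_on B linear_flow x (A *m linear_flow x + al + x *: be).
Proof.
have -> : A *m linear_flow x + al + x *: be = mexp_prim A 0 x *m al + mexp_prim A 1 x *m be.
  rewrite linear_flowE [mexp_prim A 1 x in RHS]mexp_primS [mexp_prim A 0 x]mexp_primS.
  rewrite expr0 fact0 expr1 factS fact0 !divr1 !mulmxDl mul_scalar_mx scale1r mul_scalar_mx.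
  by rewrite mulmxDr !mulmxA -addrA addrACA.
apply: (@deriv_on_sub _ _ _ setT) => //.
apply: (@deriv_on_ext _ _ _ (fun s => mexp_prim A 1 s *m al + mexp_prim A 2 s *m be)) => //.
  by move=> s _; rewrite linear_flowE.
apply: deriv_onD; exact: deriv_mexp_prim_mul.
Qed.

Lemma linear_flow0 : linear_flow 0 = 0.
Proof.
apply/colP => i; rewrite !mxE lexx set_itv1; exact: Rintegral_set1.
Qed.

End LinearFlow.

Lemma subr3_trans (V : zmodType) (a b c l l' : V) :
  a - c - (l + l') = (a - b - l) + (b - c - l').
Proof. by rewrite -subr3DD [in RHS]opprD addrA addrK. Qed.

Lemma dist_comb (R : realFieldType) (n e x y : R) :
  0 <= n -> 0 <= e -> 0 <= x -> 0 <= y -> n * e * y + e * x <= (n + 1) * e * (x + y).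
Proof.
move=> n0 e0 x0 y0; have := mulr_ge0 (mulr_ge0 n0 e0) x0; have := mulr_ge0 e0 y0.
rewrite !mulrDl !mulrDr mul1r; lra.
Qed.

(** * From the class Ck to C^k families on a tube *)

Section CkCb.
Context {R : realType} {d : nat}.
Implicit Types (D : set 'cV[R]_d) (f : R -> 'cV[R]_d -> 'cV[R]_d).

(** The mean value bound for g(s) - s l, in either direction from [t]. It turns closeness of the
    derivative to [l] near [t] into a first-order expansion at [t]. *)
Lemma mean_value_expand {V : normedModType R} (g dg : R -> V) a b t t' l e :
  a <= t <= b -> a <= t' <= b ->
  (forall s, a <= s <= b -> deriv_on [set s | a <= s <= b] g s (dg s)) ->
  (forall s, a <= s <= b -> `|s - t| <= `|t' - t| -> `|dg s - l| <= e) ->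
  `|g t' - g t - (t' - t) *: l| <= e * `|t' - t|.
Proof.
move=> tab t'ab Hd He; pose G s := g s - s *: l.
have GE : g t' - g t - (t' - t) *: l = G t' - G t.
  by rewrite /G scalerBl !opprD !opprK addrACA.
have dG u v : a <= u -> v <= b -> forall s, u <= s <= v ->
    deriv_on [set s | u <= s <= v] G s (dg s - l).
  move=> au vb s /andP[us sv]; apply: deriv_onB.
    apply: (@deriv_on_sub _ _ _ [set s | a <= s <= b]).
      by move=> r /= /andP[ur rv]; rewrite (le_trans au)// (le_trans rv).
    by apply: Hd; rewrite (le_trans au)// (le_trans sv).
  rewrite -[l in deriv_on _ _ _ l]scale1r; apply: deriv_on_scalel.
  exact: is_derive_deriv_on.
rewrite GE; have [tt'|t't] := leP t t'.
  rewrite ger0_norm ?subr_ge0//; apply: mean_value_bound => //.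
    by apply: dG; [case/andP: tab|case/andP: t'ab].
  move=> s /andP[ts st']; apply: He; first by lra.
  by rewrite !ger0_norm ?subr_ge0// lerB.
have {t't} t't := ltW t't.
rewrite distrC [`|t' - t|]distrC ger0_norm ?subr_ge0//; apply: mean_value_bound => //.
  by apply: dG; [case/andP: t'ab|case/andP: tab].
move=> s /andP[ts st']; apply: He; first by lra.
by rewrite distrC [`|t' - t|]distrC !ger0_norm ?subr_ge0// lerB.
Qed.

Lemma within_cont_at (a b : R) D f t y :
  {within `[a, b] `*` D, continuous (fun p : R * 'cV[R]_d => f p.1 p.2)} ->
  a <= t <= b -> D y -> cont_at (fun t y => a <= t <= b /\ D y) f t y.
Proof.
move=> /subspace_continuousP H tab Dy e e0.
have /H : (`[a, b] `*` D) (t, y) by split => //=; rewrite in_itv.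
move=> /cvgrPdist_lt/(_ e e0) /nbhs_ballP[eta /= eta0 He].
exists eta => // t' y' [t'ab Dy'] N; rewrite distrC; apply: (He (t', y')).
  by split; rewrite /= -ball_normE /ball_/= distrC (le_lt_trans _ N)// ?lerDl ?lerDr.
by split => //=; rewrite in_itv.
Qed.

Lemma cont_at_within (a b : R) D f :
  (forall t y, a <= t <= b -> D y -> cont_at (fun t y => a <= t <= b /\ D y) f t y) ->
  {within `[a, b] `*` D, continuous (fun p : R * 'cV[R]_d => f p.1 p.2)}.
Proof.
move=> H; apply/subspace_continuousP => -[t y] [/= tab Dy].
apply/cvgrPdist_lt => e e0; rewrite in_itv /= in tab.
have [eta eta0 He] := H _ _ tab Dy e e0; apply/nbhs_ballP.
exists (eta / 2) => /=; first by rewrite divr_gt0.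
move=> [t' y'] [/=]; rewrite -!ball_normE /ball_ /= => h1 h2 [/= t'ab Dy'].
rewrite distrC; apply: He; first by rewrite in_itv /= in t'ab.
rewrite /pdist (distrC t') (distrC y'); lra.
Qed.

(* The segment from y to y' is replaced by a path that moves one coordinate at a time. *)
Definition splice (y y' : 'cV[R]_d) (n : nat) : 'cV[R]_d :=
  \col_i (if (i < n)%N then y' i 0 else y i 0).

Lemma splice_step (y y' : 'cV[R]_d) n (nd : (n < d)%N) :
  splice y y' n.+1 = splice y y' n +
    (y' (Ordinal nd) 0 - y (Ordinal nd) 0) *: delta_mx (Ordinal nd) 0.
Proof.
apply/colP => i; rewrite !mxE eqxx andbT ltnS leq_eqVlt.
have [E|/negbTE ne] := eqVneq i (Ordinal nd).
  by rewrite E /= eqxx ltnn mulr1 addrC subrK.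
have -> : (i == n :> nat) = false by rewrite -ne -val_eqE.
by rewrite mulr0 addr0.
Qed.

(** In the maximum norm, changing one coordinate at a time never leaves the ball of radius |y' - y|
    around y, so the whole path stays in a neighbourhood of y contained in the domain. *)
Lemma splice_dist (y y' : 'cV[R]_d) n (nd : (n < d)%N) r :
  `|r| <= `|y' (Ordinal nd) 0 - y (Ordinal nd) 0| ->
  `|splice y y' n + r *: delta_mx (Ordinal nd) 0 - y| <= `|y' - y|.
Proof.
move=> Hr; have E i : `|y' i 0 - y i 0| <= `|y' - y|.
  by have := mx_norm_ge (y' - y) i 0; rewrite !mxE.
apply: mx_norm_le => // i j; rewrite !mxE ord1 eqxx andbT.
have [->|ne] := eqVneq i (Ordinal nd).
  by rewrite /= ltnn mulr1 addrAC subrr add0r (le_trans Hr).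
rewrite mulr0 addr0; case: ifP => _ //.
by rewrite subrr normr0.
Qed.

(** Continuous partial derivatives give joint differentiability: move first in time with y fixed,
    then along the coordinates at time t', and apply [mean_value_expand] to each move. *)
Lemma Ck_frechet k (a b : R) D f t y : open D -> Ck k.+1 a b D f -> a <= t <= b -> D y ->
  frechet (fun t y => a <= t <= b /\ D y) f t y (partial_t a b f t y)
    (fun i => partial_x i f t y).
Proof.
move=> oD [_ [Hd Ht Hx]] tab Dy e e0; have d1 : 0 < d%:R + 1 :> R by apply: ltr_wpDl.
(* The tolerance is shared by [d + 1] moves, one in time and one per coordinate. *)
have e1 := divr_gt0 e0 d1; set e' := e / (d%:R + 1) in e1.
have cC g : Ck k a b D g -> cont_at (fun t y => a <= t <= b /\ D y) g t y.
  by case: k {Hd Ht Hx} => [|k] [cg _]; exact: within_cont_at cg tab Dy.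
have [eta eta0 He] := cC _ Ht _ e1.
have [||et et0 Het] := @uniform_eta R d (fun i eta => forall t' y', (a <= t' <= b /\ D y') ->
    pdist t' t y' y < eta -> `|partial_x i f t' y' - partial_x i f t y| < e').
- by move=> i u v uv Hv t' y' O N; apply: Hv => //; exact: lt_le_trans uv.
- by move=> i; have [et et0 Het] := cC _ (Hx i) _ e1; exists et.
have /nbhs_normP[r0 /= r00 Hr] : nbhs y D by exact: open_nbhs_nbhs.
exists (Num.min r0 (Num.min eta et)); first by rewrite !lt_min r00 eta0.
move=> t' y' [t'ab Dy']; rewrite !lt_min => /andP[N0 /andP[N1 N2]].
have inD z : `|z - y| <= `|y' - y| -> D z.
  move=> zy; apply: Hr; rewrite /= distrC (le_lt_trans zy)//.
  by rewrite (le_lt_trans _ N0)// lerDr.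
have S1 : `|f t' y - f t y - (t' - t) *: partial_t a b f t y| <= e' * `|t' - t|.
  apply: (@mean_value_expand _ (fun s => f s y) (fun s => partial_t a b f s y) a b) => //.
    move=> s sab; have [[l Hl] _] := Hd s y sab Dy; apply/is_derive_inP.
    have Pl : is_derive_in a b (fun s => f s y) s (partial_t a b f s y).
      exact: (cvgP _ Hl).
    exact: Pl.
  move=> s sab st; apply/ltW/He => //; rewrite (le_lt_trans _ N1)// /pdist subrr normr0 addr0.
  by rewrite (le_trans st)// lerDl.
have S2 n : (n <= d)%N -> `|f t' (splice y y' n) - f t' y -
    \sum_(i < d | (i < n)%N) (y' - y) i 0 *: partial_x i f t y| <= n%:R * e' * `|y' - y|.
  elim: n => [_|n IH nd].
    rewrite big_pred0 => [|i]; last by rewrite ltn0.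
    have -> : splice y y' 0 = y by apply/colP => i; rewrite mxE ltn0.
    by rewrite !subrr normr0 !mul0r.
  have {}IH := IH (ltnW nd); pose z := splice y y' n; pose o := Ordinal nd.
  pose del := y' o 0 - y o 0.
  have Dd : `|del| <= `|y' - y| by have := mx_norm_ge (y' - y) o 0; rewrite !mxE.
  have S3 : `|f t' (z + del *: delta_mx o 0) - f t' (z + 0 *: delta_mx o 0)
      - (del - 0) *: partial_x o f t y| <= e' * `|del - 0|.
    have zr r : - `|del| <= r <= `|del| -> `|z + r *: delta_mx o 0 - y| <= `|y' - y|.
      by rewrite -ler_norml => rd; exact: splice_dist.
    apply: (@mean_value_expand _ (fun r => f t' (z + r *: delta_mx o 0))
      (fun r => partial_x o f t' (z + r *: delta_mx o 0)) (- `|del|) `|del|).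
    - by rewrite oppr_le0 normr_ge0.
    - by rewrite -ler_norml.
    - move=> r /zr/inD Dr; apply: derive_deriv_on.
      by have [_] := Hd t' _ t'ab Dr; exact.
    - move=> r /zr rd _; apply/ltW/Het; first by split => //; exact: inD.
      by apply: le_lt_trans N2; rewrite lerD2l.
  rewrite (bigD1 o) /= ?ltnSn//; rewrite (eq_bigl (fun i : 'I_d => (i < n)%N)); last first.
    by move=> i; rewrite ltnS -val_eqE /= andbC ltn_neqAle.
  rewrite subr0 scale0r addr0 in S3.
  rewrite splice_step -/o -/del -/z.
  set S := \sum_(i < d | (i < n)%N) _ in IH *.
  have -> : (y' - y) o 0 = del by rewrite !mxE.
  rewrite (@subr3_trans _ _ (f t' z)) (le_trans (ler_normD _ _))//.
  have e'd : e' * `|del| <= e' * `|y' - y| by rewrite ler_wpM2l// ltW.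
  rewrite -natr1 !mulrDl mul1r addrC lerD//; exact: le_trans S3 e'd.
have {}S2 := S2 d (leqnn d).
have spd : splice y y' d = y' by apply/colP => i; rewrite mxE ltn_ord.
rewrite spd in S2; rewrite (eq_bigl xpredT) in S2; last by move=> i; rewrite ltn_ord.
rewrite /lin; set S := \sum_i _ in S2 *.
rewrite [_ + S]addrC (@subr3_trans _ _ (f t' y)) (le_trans (ler_normD _ _))//.
apply: (@le_trans _ _ ((d%:R + 1) * e' * pdist t' t y' y)); last first.
  by rewrite [_ * e']mulrC divfK ?gt_eqF.
apply: (@le_trans _ _ (d%:R * e' * `|y' - y| + e' * `|t' - t|)); first exact: lerD.
by apply: dist_comb => //; exact: ltW.
Qed.

End CkCb.

(** * Return to the class [Ck], and compact tubes around a trajectory *)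

Section CkCbEquivalence.
Context {R : realType} {d : nat}.
Implicit Types (D : set 'cV[R]_d) (f : R -> 'cV[R]_d -> 'cV[R]_d).

Definition cyl (a b : R) D : unit -> R -> 'cV[R]_d -> Prop := fun _ t y => a <= t <= b /\ D y.

(** Since a < b, there is room on at least one side of [t]. Properness makes the limit unique, so
    that [derive_in], defined by [lim], is the derivative. *)
Lemma is_derive_in_proper (a b t : R) : a < b -> a <= t <= b ->
  ProperFilter (within [set h | a <= t + h <= b] (0 : R)^').
Proof.
move=> ab tab; apply: Build_ProperFilter_ex => P /nbhs_normP[eta /= eta0 He].
have [tb|bt] := ltP t b.
  pose s := Num.min (eta / 2) (b - t).
  have s0 : 0 < s by rewrite lt_min divr_gt0//= subr_gt0.
  have s1 : s <= eta / 2 by rewrite ge_min lexx.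
  have s2 : s <= b - t by rewrite ge_min lexx orbT.
  exists s; apply: He => /=; rewrite ?gt_eqF//; last by lra.
  by rewrite sub0r normrN gtr0_norm//; lra.
have ta : a < t by lra.
pose s := Num.min (eta / 2) (t - a).
have s0 : 0 < s by rewrite lt_min divr_gt0//= subr_gt0.
have s1 : s <= eta / 2 by rewrite ge_min lexx.
have s2 : s <= t - a by rewrite ge_min lexx orbT.
exists (- s); apply: He => /=; rewrite ?oppr_eq0 ?gt_eqF//; last by lra.
by rewrite sub0r opprK gtr0_norm//; lra.
Qed.

Lemma derive_in_eq (a b : R) (g : R -> 'cV[R]_d) t l : a < b -> a <= t <= b ->
  is_derive_in a b g t l -> derive_in a b g t = l.
Proof.
move=> ab tab H; have PF := is_derive_in_proper ab tab.
exact: (@cvg_lim _ _ _ _ _ _ _ H).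
Qed.

(** Needed because [rk_order] is stated for fields of class [Ck]. The partial derivatives of [Ck]
    are canonical, those of [Cb] merely exist; uniqueness of derivatives identifies them at each
    level. *)
Lemma Cb_Ck k (a b : R) D f : a < b -> open D -> Cb (cyl a b D) k (fun _ => f) ->
  Ck k a b D f.
Proof.
move=> ab oD; elim: k f => [|k IH] f Hf.
  by split=> //; apply: cont_at_within => t y tab Dy; exact: (Cb_cont Hf (c := tt)).
split; first by apply: cont_at_within => t y tab Dy; exact: (Cb_cont Hf (c := tt)).
have /CbS[_ [Ft [Fx [HF Ht Hx]]]] := Hf.
have Dt t y : a <= t <= b -> D y -> is_derive_in a b (fun s => f s y) t (Ft tt t y).
  move=> tab Dy; apply/is_derive_inP.
  by apply: (frechet_deriv_on (O := cyl a b D tt)) (HF tt t y _).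
have Dx t y i : a <= t <= b -> D y ->
    derivable (f t) y (delta_mx i 0) /\ partial_x i f t y = Fx i tt t y.
  move=> tab Dy; have /nbhs_normP[r0 /= r00 Hr] : nbhs y D by exact: open_nbhs_nbhs.
  have n1 : 0 < `|delta_mx i 0 : 'cV[R]_d| + 1 by apply: ltr_wpDl.
  apply: (@deriv_on_derive _ _ _ _ _ _ _ (r0 / (`|delta_mx i 0 : 'cV[R]_d| + 1))).
    exact: divr_gt0.
  move=> e e0; have [eta eta0 He] := HF tt t y (conj tab Dy) _ (divr_gt0 e0 n1).
  exists (eta / (`|delta_mx i 0 : 'cV[R]_d| + 1)); first exact: divr_gt0.
  have small s E : `|s| < E / (`|delta_mx i 0 : 'cV[R]_d| + 1) ->
      `|s *: (delta_mx i 0 : 'cV[R]_d)| < E.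
    rewrite ltr_pdivlMr// => /(le_lt_trans _); apply.
    by rewrite normrZ ler_wpM2l// lerDl.
  move=> s /= /small s1; rewrite subr0 => /small s2.
  have := He t (y + s *: delta_mx i 0).
  rewrite /pdist subrr normr0 add0r addrAC subrr add0r => /(_ _ s2) H.
  rewrite scale0r addr0; apply: le_trans (le_trans (H _) _).
  - rewrite le_eqVlt; apply/orP; left; apply/eqP; congr (`|_ - _|).
    rewrite /lin scale0r add0r (bigD1 i)//= big1 ?addr0 ?mxE ?eqxx ?mulr1//.
    by move=> j ji; rewrite !mxE (negbTE ji) mulr0 scale0r.
  - by split=> //; apply: Hr; rewrite /= opprD addrA subrr sub0r normrN.
  - rewrite normrZ mulrC -mulrA [e * _]mulrC ler_wpM2l//.
    exact: divr_succ_mul_le.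
split=> [t y tab Dy||i].
- by split; [exists (Ft tt t y); exact: Dt|move=> i; have [] := Dx t y i tab Dy].
- apply: IH; apply: Cb_ext Ht => -[] t y [tab Dy].
  by rewrite /partial_t (derive_in_eq ab tab (Dt _ _ tab Dy)).
- apply: IH; apply: Cb_ext (Hx i) => -[] t y [tab Dy].
  by have [_ ->] := Dx t y i tab Dy.
Qed.

Section Tube.
Variables (a b : R) (x : R -> 'cV[R]_d).

Definition tube (r : R) : unit -> R -> 'cV[R]_d -> Prop :=
  fun _ t y => a <= t <= b /\ `|y - x t| <= r.

Hypothesis xcont : forall t, a <= t <= b -> forall e, 0 < e ->
  exists2 eta, 0 < eta & forall s, a <= s <= b -> `|s - t| < eta -> `|x s - x t| < e.

(** Compactness of [a, b] in near-covering form. One integer [n] governs both the radius and the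
    bound, so the conclusion holds for all large [n] and several such facts can be intersected. *)
Lemma tube_bounded D f : open D -> (forall t, a <= t <= b -> D (x t)) ->
  (forall t y, a <= t <= b -> D y -> cont_at (cyl a b D tt) f t y) ->
  \forall n \near \oo, forall t y, tube n.+1%:R^-1 tt t y -> D y /\ `|f t y| <= n%:R.
Proof.
move=> oD Dx cf.
pose P (n : nat) t := forall y, `|y - x t| <= n.+1%:R^-1 -> D y /\ `|f t y| <= n%:R.
have : \forall n \near \oo, `[a, b] `<=` P n.
  apply: (proj2 (near_covering_withinP _) (proj1 (compact_near_coveringP _) (@segment_compact R a b))).
  move=> t /=; rewrite in_itv /= => tab.
  have /nbhs_normP[r0 /= r00 Hr] : nbhs (x t) D by apply: open_nbhs_nbhs; split=> //; exact: Dx.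
  have [eta eta0 He] := cf _ _ tab (Dx _ tab) 1 ltr01.
  pose r := Num.min r0 eta.
  have r_gt0 : 0 < r / 2 by rewrite divr_gt0// lt_min r00.
  have r4 : 0 < r / 4 by rewrite divr_gt0// lt_min r00.
  have [et et0 Het] := xcont tab r4.
  (* Three quarters of [r] are spent: on the distance in time, on the radius of the tube and on the
     displacement of x. The bound n >= 4 / r makes the radius at most r / 4. *)
  exists (ball t (Num.min et (r / 4)), [set n | r^-1 * 4 <= n%:R /\ `|f t (x t)| + 1 <= n%:R]).
    split=> /=; first by apply: nbhsx_ballx; rewrite lt_min et0.
    by apply: filterI; exact: nbhs_infty_ger.
  case=> t' n /= [tt' [n1 n2]]; rewrite in_itv /= => t'ab y yx.
  move: tt'; rewrite -ball_normE /ball_ /= distrC lt_min => /andP[t1 t2].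
  have x1 := Het _ t'ab t1.
  have n0 : n.+1%:R^-1 <= r / 4.
    rewrite -[r / 4]invrK lef_pV2 ?posrE ?invr_gt0// invfM invrK.
    by rewrite (le_trans n1)// ler_nat.
  have yxt : `|y - x t| < r / 2.
    rewrite -(subrKA (x t')) (le_lt_trans (ler_normD _ _))//.
    have -> : r / 2 = r / 4 + r / 4 by lra.
    by rewrite ler_ltD// (le_trans yx).
  have rr0 : r <= r0 by rewrite ge_min lexx.
  have re : r <= eta by rewrite ge_min lexx orbT.
  have Dy : D y by apply: Hr; rewrite /= distrC; apply: lt_trans yxt _; lra.
  split=> //.
  have := He t' y (conj t'ab Dy); rewrite /pdist => /(_ _) H.
  have {}H : `|f t' y - f t (x t)| < 1 by apply: H; lra.
  have := ler_normD (f t' y - f t (x t)) (f t (x t)); rewrite subrK; lra.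
apply: filterS => n H t y [tab yx].
by apply: (H t) => //=; rewrite in_itv.
Qed.

(** Differentiability comes from [Ck_frechet] on the open set and restricts to the tube. Stated for
    all large [n] so that the induction hypotheses for the finitely many partial derivatives share a
    radius. *)
Lemma Ck_tube k D f : open D -> (forall t, a <= t <= b -> D (x t)) -> Ck k a b D f ->
  \forall n \near \oo, Cb (tube n.+1%:R^-1) k (fun _ => f).
Proof.
move=> oD Dx; elim: k f => [|k IH] f Hf.
  have cf t y : a <= t <= b -> D y -> cont_at (cyl a b D tt) f t y.
    by move=> tab Dy; case: Hf => cf _; exact: within_cont_at cf tab Dy.
  apply: filterS (tube_bounded oD Dx cf) => n H; split.
    by exists n%:R => -[] t y /H[].
  move=> [] t y O e e0; have [eta eta0 He] := cf t y (proj1 O) (proj1 (H _ _ O)) e e0.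
  by exists eta => // t' y' O'; apply: He; split; [case: O'|case: (H _ _ O')].
have cf t y : a <= t <= b -> D y -> cont_at (cyl a b D tt) f t y.
  by move=> tab Dy; case: Hf => cf _; exact: within_cont_at cf tab Dy.
have fr := Ck_frechet oD Hf.
have [_ [_ Ht Hx]] : _ /\ [/\ _, Ck k a b D (partial_t a b f) &
  forall i, Ck k a b D (partial_x i f)] := Hf.
have Hx' : \forall n \near \oo, forall i, Cb (tube n.+1%:R^-1) k (fun _ => partial_x i f).
  by apply: filter_forall => i; apply: IH.
apply: filterS3 (tube_bounded oD Dx cf) (IH _ Ht) Hx' => n H {}Ht {}Hx.
apply/CbS; split; first by exists n%:R => -[] t y /H[].
exists (fun _ => partial_t a b f), (fun i _ => partial_x i f); split=> // -[] t y O.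
move=> e e0; have [eta eta0 He] := fr t y (proj1 O) (proj1 (H _ _ O)) e e0.
by exists eta => // t' y' O'; apply: He; split; [case: O'|case: (H _ _ O')].
Qed.

End Tube.
End CkCbEquivalence.

(** * Local linearization and its local error *)

Section SmallTime.
Context {R : realType}.

(** At a point c where |w| is largest on [-|r|, |r|], the mean value bound gives |w c| <= (L |w c| +
    A) |c|, and L |c| <= 1/2 absorbs the first term. Both signs of r are covered at once. *)
Lemma gronwall_small {n} (w dw : R -> 'cV[R]_n) (L A rho : R) :
  w 0 = 0 -> (forall r, deriv_on setT w r (dw r)) -> 0 <= L -> 0 <= A -> L * rho <= 2^-1 ->
  (forall r, `|r| <= rho -> `|dw r| <= L * `|w r| + A) ->
  forall r, `|r| <= rho -> `|w r| <= 2 * A * `|r|.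
Proof.
move=> w0 Hw L0 A0 Lr Hdw r rr.
have cw : {within `[- `|r|, `|r|], continuous (fun s => `|w s|)}.
  apply: continuous_subspaceT => s; apply/cvgrPdist_lt => e e0.
  have [eta eta0 He] := deriv_on_cont (Hw s) e0.
  apply/nbhs_normP; exists eta => //= v sv.
  move: sv; rewrite /= distrC => sv; apply: le_lt_trans (He v I sv).
  by rewrite distrC; exact: ler_dist_dist.
have le : - `|r| <= `|r| by rewrite ge0_cp.
have [c] := EVT_max le cw; rewrite in_itv /= => cr Hc.
have cr' : `|c| <= `|r| by rewrite ler_norml.
have := @mean_value_expand _ _ w dw (- `|r|) (`|r|) 0 c 0 (L * `|w c| + A).
rewrite oppr_le0 normr_ge0 /= cr w0 scaler0 !subr0 => /(_ _ _ _ _) H.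
have {}H : `|w c| <= (L * `|w c| + A) * `|c|.
  apply: H => // [s _|s sr _].
    exact: deriv_on_sub (Hw s).
  rewrite subr0 (le_trans (Hdw s _))//; first by rewrite (le_trans _ rr)// ler_norml.
  by rewrite lerD2r ler_wpM2l// Hc// in_itv.
have H1 : L * `|w c| * `|c| <= 2^-1 * `|w c|.
  rewrite mulrAC ler_wpM2r// (le_trans _ Lr)// ler_wpM2l//; exact: le_trans rr.
have H2 : A * `|c| <= A * `|r| by rewrite ler_wpM2l.
have H3 : `|w r| <= `|w c| by apply: Hc; rewrite in_itv /= -ler_norml.
rewrite mulrDl in H; lra.
Qed.

(** At a fixed time the tube is a ball, hence convex: the segment from y to y' stays in it and the
    mean value bound applies along that segment. *)
Lemma Cb_lip {d} {V : normedModType R} (a b : R) (x : R -> 'cV[R]_d) r (F : R -> 'cV[R]_d -> V) k :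
  Cb (tube a b x r) k.+1 (fun _ => F) -> exists2 L, 0 < L & forall t y y',
    tube a b x r tt t y -> tube a b x r tt t y' -> `|F t y' - F t y| <= L * `|y' - y|.
Proof.
move=> /CbS[_ [Ft [Fx [HF Ht Hx]]]].
have [Mt Mt0 HMt] := Cb_bound Ht.
have /choice[Mx HMx] : forall i, exists M, 0 < M /\ forall c t y, tube a b x r c t y -> `|Fx i c t y| <= M.
  by move=> i; have [M M0 HM] := Cb_bound (Hx i); exists M.
exists (Mt + \sum_i Mx i).
  by rewrite ltr_pwDl// sumr_ge0// => i _; have [/ltW] := HMx i.
move=> t y y' [tab yx] [_ yx'].
pose z (u : R) := y + u *: (y' - y).
have zT u : 0 <= u <= 1 -> tube a b x r tt t (z u).
  move=> /andP[u0 u1]; split=> //.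
  have -> : z u - x t = (1 - u) *: (y - x t) + u *: (y' - x t).
    rewrite scalerBl scale1r [RHS]addrAC -[RHS]addrA -scalerBr opprB subrKA.
    by rewrite /z addrAC.
  rewrite (le_trans (ler_normD _ _))// !normrZ !ger0_norm ?subr_ge0//.
  have -> : r = (1 - u) * r + u * r by ring.
  by rewrite lerD// ler_wpM2l// subr_ge0.
have := @mean_value_bound _ _ (fun u => F t (z u))
  (fun u => lin (Ft tt t (z u)) (fun i => Fx i tt t (z u)) 0 (y' - y)) 0 1
  ((Mt + \sum_i Mx i) * `|y' - y|) ler01.
have z0 : z 0 = y by rewrite /z scale0r addr0.
have z1 : z 1 = y' by rewrite /z scale1r addrC subrK.
rewrite z0 z1 subr0 mulr1 => H.
apply: H => u u01.
  move=> e e0; have n1 : 0 < `|y' - y| + 1 by apply: ltr_wpDl.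
  have [eta eta0 He] := HF tt t (z u) (zT _ u01) _ (divr_gt0 e0 n1).
  exists (eta / (`|y' - y| + 1)) => [|v /= v01 vu]; first exact: divr_gt0.
  have E : z v - z u = (v - u) *: (y' - y) by rewrite /z opprD addrACA subrr add0r scalerBl.
  have N : pdist t t (z v) (z u) = `|v - u| * `|y' - y|.
    by rewrite /pdist subrr normr0 add0r E normrZ.
  have := He t (z v) (zT _ v01); rewrite N E subrr.
  have -> : lin (Ft tt t (z u)) (fun i => Fx i tt t (z u)) 0 ((v - u) *: (y' - y)) =
    (v - u) *: lin (Ft tt t (z u)) (fun i => Fx i tt t (z u)) 0 (y' - y).
    by rewrite -lin_argZ mulr0.
  move=> {}H; apply: le_trans (H _) _.
    move: vu; rewrite ltr_pdivlMr// => /(le_lt_trans _); apply.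
    by rewrite ler_wpM2l// lerDl.
  by rewrite mulrC -mulrA [e * _]mulrC ler_wpM2l//; exact: divr_succ_mul_le.
rewrite (le_trans (lin_bound _ _ _ _))// normr0 add0r ler_wpM2r// /lin_norm.
rewrite lerD//; first by apply: HMt; exact: zT.
by apply: ler_sum => i _; have [_] := HMx i; apply; exact: zT.
Qed.

(** Bootstrap on the linear equation, whose right-hand side is affine in the flow: bounds on the
    data and on the flow suffice for every [k]. The affine argument covers both phi at t - tau and
    phi at c_i r. *)
Lemma linear_flow_Cb {C m d} (O : C -> R -> 'cV[R]_m -> Prop) (A : C -> 'M[R]_d)
    (al be : C -> 'cV[R]_d) (ka : R) (nu : C -> R) M k :
  (forall c t y, O c t y -> [/\ `|A c| <= M, `|al c| <= M, `|be c| <= M, `|t| <= M & `|nu c| <= M] /\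
     `|linear_flow (A c) (al c) (be c) (ka * t + nu c)| <= M) ->
  Cb O k (fun c t _ => linear_flow (A c) (al c) (be c) (ka * t + nu c)).
Proof.
move=> HM; pose H c t := ka *: (A c *m linear_flow (A c) (al c) (be c) (ka * t + nu c) + al c
  + (ka * t + nu c) *: be c).
have dH c t y : O c t y -> deriv_on setT
    (fun t => linear_flow (A c) (al c) (be c) (ka * t + nu c)) t (H c t).
  by move=> Oc; apply: deriv_on_affine (deriv_linear_flow _ _ _ setT _).
elim: k => [|k IH].
  by apply: (Cb_curve0 (B := fun=> setT) (H := H) (M := M)) => // c t y /HM[].
apply: (Cb_curve (B := fun=> setT) (H := H) (M := M)) => // [c t y /HM[]//|].
rewrite /H; apply: Cb_scale; apply: CbD; first apply: CbD.
- by apply: (Cb_mulmx (M := M)) => // c t y /HM[[]].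
- by apply: (Cb_cst _ (M := M)) => c t y /HM[[]].
- apply: CbZ; last by apply: (Cb_cst _ (M := M)) => c t y /HM[[]].
  apply: CbD; last by apply: (Cb_cst _ (M := M)) => c t y /HM[[]].
  by apply: Cb_scale; apply: (Cb_time _ (M := M)) => c t y /HM[[]].
Qed.

End SmallTime.

(** * Algebraic identities, numerical estimates and the discrete Gronwall lemma *)

Lemma subr4 (R : comRingType) n (a b c e a' b' c' e' : 'cV[R]_n) :
  a - b - c - e - (a' - b' - c' - e') = (a - a') - (b - b') - (c - c') - (e - e').
Proof. by apply/colP => k; rewrite !mxE; ring. Qed.

Lemma affine_flow_sub (R : comRingType) n (A A' : 'M[R]_n) (p p' a a' b b' : 'cV[R]_n) (u : R) :
  A' *m p' + a' + u *: b' - (A *m p + a + u *: b) =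
  A' *m (p' - p) + ((A' - A) *m p + (a' - a) + u *: (b' - b)).
Proof.
rewrite mulmxBr mulmxBl; move: (A' *m p') (A' *m p) (A *m p) => A1 A2 A3.
by apply/colP => k; rewrite !mxE; ring.
Qed.

(** The 5 is 4 from the growth of phi plus 1 from the speed of x; [h * AB] bounds the Runge-Kutta
    term of a stage argument. *)
Lemma tube_budget (R : realFieldType) (ep M C AB h a b c p q k w : R) :
  a <= ep / 2 -> p <= 4 * M * c -> k <= h * AB -> w <= M * c -> M * c <= M * (C * h) ->
  (5 * M * C + AB) * h <= ep / 2 -> b <= q + w -> q <= p + k -> a + b <= ep.
Proof. rewrite mulrDl; lra. Qed.

Lemma mulmx_sub_split (R : comRingType) n (A A' : 'M[R]_n) (p p' : 'cV[R]_n) :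
  A *m p - A' *m p' = (A - A') *m p' + A *m (p - p').
Proof. by rewrite mulmxBl mulmxBr [RHS]addrC subrKA. Qed.

Lemma stage_lip_budget (R : realFieldType) (V : normedZmodType R) (K L1 L2 L3 L4 N : R)
    (a b c e : V) : 0 <= K * N -> `|a| <= L1 * N -> `|b| <= L2 * N -> `|c| <= L3 * N ->
  `|e| <= L4 * N -> `|a - b - c - e| <= (K + (L1 + L2 + L3 + L4)) * N.
Proof.
move=> KN Ha Hb Hc He; have := ler_normB (a - b - c) e; have := ler_normB (a - b) c.
have := ler_normB a b; rewrite !mulrDl; lra.
Qed.

Lemma deriv_on_translate (R : realType) (V : normedModType R) (A B : set R) (g : R -> V) t nu l :
  (forall s, B s -> A (s + nu)) -> deriv_on A g (t + nu) l ->
  deriv_on B (fun s => g (s + nu)) t l.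
Proof.
move=> BA H e e0; have [eta eta0 He] := H _ e0; exists eta => // s Bs st.
by have := He (s + nu) (BA _ Bs); rewrite opprD addrACA subrr addr0; exact.
Qed.

(** The inductive step for the majorant c a exp(KL a), through 1 + KL del <= exp(KL del). *)
Lemma gronwall_step (R : realType) (KL del a c e g p G : R) :
  0 <= KL -> 0 <= del -> 0 <= a -> 0 <= c ->
  g <= c * del -> e <= c * (a * expR (KL * a)) -> p <= KL * del * e ->
  G = c * ((a + del) * expR (KL * (a + del))) -> g + e + p <= G.
Proof.
move=> K0 d0 a0 c0 Hg He Hp ->.
have e0 : 0 <= expR (KL * a) by exact: expR_ge0.
have Kd : 0 <= KL * del by exact: mulr_ge0.
have E1 : 1 + KL * del <= expR (KL * del) by exact: expR_ge1Dx.
have E2 : 1 <= expR (KL * (a + del)).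
  by apply: le_trans (expR_ge1Dx _); rewrite lerDl mulr_ge0// addr_ge0.
have H1 : (1 + KL * del) * (c * (a * expR (KL * a))) <= c * (a * expR (KL * (a + del))).
  have -> : (1 + KL * del) * (c * (a * expR (KL * a))) = c * a * ((1 + KL * del) * expR (KL * a)).
    by ring.
  by rewrite [leRHS]mulrA ler_wpM2l ?mulr_ge0// mulrDr expRD [leRHS]mulrC ler_wpM2r.
have H2 : c * del <= c * (del * expR (KL * (a + del))).
  by rewrite ler_wpM2l// ler_peMr.
have H3 : (1 + KL * del) * e <= (1 + KL * del) * (c * (a * expR (KL * a))).
  by rewrite ler_wpM2l// addr_ge0.
move: H1 H2 H3 Hg Hp; rewrite !mulrDl !mulrDr mul1r; lra.
Qed.

Lemma partition_range (R : realDomainType) (t : nat -> R) N :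
  (forall n, (n < N)%N -> t n <= t n.+1) -> forall n, (n <= N)%N -> t 0%N <= t n <= t N.
Proof.
move=> tS; have up k : (k <= N)%N -> t 0%N <= t k.
  elim: k => [|k IH] kN; first by [].
  by rewrite (le_trans (IH (ltnW kN)))// tS.
have down k : (k <= N)%N -> t (N - k)%N <= t N.
  elim: k => [|k IH] kN; first by rewrite subn0.
  have kN' : (N - k.+1 < N)%N by rewrite ltn_subrL (leq_trans _ kN).
  by apply: le_trans (IH (ltnW kN)); have := tS _ kN'; rewrite subnSK.
by move=> n nN; rewrite up//=; have := down _ (leq_subr n N); rewrite subKn.
Qed.

(** The recursion is assumed only while [e n <= B], as the increment is Lipschitz only inside the
    tube. The majorant [G] never exceeds [B] on the partition, so the induction keeps the recursion
    available. *)
Lemma discrete_gronwall (R : realType) (t e : nat -> R) N KL c B :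
  0 <= KL -> 0 <= c -> e 0%N = 0 -> (forall n, (n < N)%N -> t n <= t n.+1) ->
  c * ((t N - t 0%N) * expR (KL * (t N - t 0%N))) <= B ->
  (forall n, (n < N)%N -> e n <= B ->
     e n.+1 <= c * (t n.+1 - t n) + e n + KL * (t n.+1 - t n) * e n) ->
  forall n, (n < N)%N -> e n.+1 <= B.
Proof.
move=> K0 c0 e0 tS cB eS.
pose G n := c * ((t n - t 0%N) * expR (KL * (t n - t 0%N))).
have tT := partition_range tS.
have GB n : (n <= N)%N -> G n <= B.
  move=> nN; have /andP[n1 n2] := tT n nN; apply: le_trans cB.
  rewrite /G ler_wpM2l// ler_pM ?expR_ge0 ?subr_ge0 ?lerD2r//.
  by rewrite ler_expR ler_wpM2l// lerD2r.
suff main n : (n <= N)%N -> e n <= G n.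
  by move=> n nN; exact: le_trans (main _ nN) (GB _ nN).
elim: n => [_|n IH nN]; first by rewrite e0 /G subrr mul0r mulr0.
have {}IH := IH (ltnW nN); have /andP[tn _] := tT n (ltnW nN).
apply: le_trans (eS n nN (le_trans IH (GB _ (ltnW nN)))) _.
apply: (@gronwall_step _ KL (t n.+1 - t n) (t n - t 0%N) c _ _ _ _ K0 _ _ c0 (lexx _) IH (lexx _)).
- by rewrite subr_ge0 tS.
- by rewrite subr_ge0.
- by have -> : t n - t 0%N + (t n.+1 - t n) = t n.+1 - t 0%N by ring.
Qed.

Section Regrouping.
Context {R : comRingType} {n : nat}.
Implicit Types a b c e p y : 'cV[R]_n.

Lemma deviation_split a p y c : a + p + y - c = y + (p - (c - a)).
Proof. by apply/colP => k; rewrite !mxE; ring. Qed.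

Lemma deviation_cancel a b p : a + p + (b - a - p) = b.
Proof. by apply/colP => k; rewrite !mxE; ring. Qed.

Lemma residual_regroup b p c e : b - p - c - e = b - (p + e + c).
Proof. by apply/colP => k; rewrite !mxE; ring. Qed.

Lemma increment_regroup b a p c : b - a - p - 0 - c = b - a - (p + c).
Proof. by rewrite subr0 opprD [RHS]addrA. Qed.

End Regrouping.

Lemma step_bound (R : numDomainType) (V : normedZmodType R) (b a y p q : V) (A B : R) :
  `|b - a - p| <= A -> `|q - p| <= B -> `|b - (y + q)| <= A + `|a - y| + B.
Proof.
move=> Ha Hq; have -> : b - (y + q) = (b - a - p) + (a - y) - (q - p).
  by rewrite opprB [b - a - p]addrAC subrKA [b - p - y]addrAC subrKA opprD addrA.
by rewrite (le_trans (ler_normB _ _))// lerD// (le_trans (ler_normD _ _))// lerD.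
Qed.

(** * Estimates for the linear flow and for the stages inside the tube *)

Section LocalLinearization.
Context {R : realType} {d s : nat}.
Variables (t0 T : R) (f : R -> 'cV[R]_d -> 'cV[R]_d) (rk : rk_tableau R s).
Variables (x : R -> 'cV[R]_d) (ep M L rho : R).

Let Tb t y := tube t0 T x ep tt t y.
Let ft := partial_t t0 T f.
Let J := jacobian_x f.
Let phi := ll_phi t0 T f.

Hypothesis xsol : forall t, t0 <= t <= T -> deriv_on [set s | t0 <= s <= T] x t (f t (x t)).
Hypothesis ep0 : 0 < ep.
Hypothesis M0 : 0 < M.
Hypothesis L0 : 0 < L.
Hypothesis fM : forall t y, Tb t y -> `|f t y| <= M.
Hypothesis ftM : forall t y, Tb t y -> `|ft t y| <= M.
Hypothesis JM : forall t y, Tb t y -> `|J t y| <= M.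
Hypothesis fL : forall t y y', Tb t y -> Tb t y' -> `|f t y' - f t y| <= L * `|y' - y|.
Hypothesis ftL : forall t y y', Tb t y -> Tb t y' -> `|ft t y' - ft t y| <= L * `|y' - y|.
Hypothesis JL : forall t y y', Tb t y -> Tb t y' -> `|J t y' - J t y| <= L * `|y' - y|.
(* On |r| <= rho the linear flow is controlled by the smallness condition of gronwall_small. *)
Hypothesis rho0 : 0 < rho.
Hypothesis rho1 : rho <= 1.
Hypothesis rhoM : d%:R * M * rho <= 2^-1.

Lemma tube_x t : t0 <= t <= T -> Tb t (x t).
Proof. by move=> tT; split=> //; rewrite subrr normr0 ltW. Qed.

Lemma tube_half t y : t0 <= t <= T -> `|y - x t| <= ep / 2 -> Tb t y.
Proof. by move=> tT yx; split=> //; have := ep0; lra. Qed.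

Lemma x_lip t t' : t0 <= t <= T -> t0 <= t' <= T -> `|x t' - x t| <= M * `|t' - t|.
Proof.
move=> tT t'T; have := @mean_value_expand _ _ x (fun t => f t (x t)) t0 T t t' 0 M tT t'T xsol.
by rewrite scaler0 subr0; apply=> r rT _; rewrite subr0; exact/fM/tube_x.
Qed.

Lemma deriv_phi t y B r : deriv_on B (phi t y) r (J t y *m phi t y r + f t y + r *: ft t y).
Proof. exact: deriv_linear_flow. Qed.

Lemma phi0 t y : phi t y 0 = 0.
Proof. exact: linear_flow0. Qed.

Lemma dM0 : 0 <= d%:R * M.
Proof. by rewrite mulr_ge0// ltW. Qed.

(** Apply [gronwall_small] to the equation of phi with matrix bound d M and forcing bound 2 M, from
    f + r f_t with |r| <= 1; the factor [d] is that of products in the maximum norm. *)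
Lemma phi_bound t y r : Tb t y -> `|r| <= rho -> `|phi t y r| <= 4 * M * `|r|.
Proof.
move=> Ty; have -> : 4 * M = 2 * (2 * M) by ring.
apply: (gronwall_small (phi0 t y) (deriv_phi t y setT) dM0 _ rhoM) => [|u ur].
  by rewrite mulr_ge0// ltW.
rewrite -addrA (le_trans (ler_normD _ _))// lerD//.
  rewrite (le_trans (mx_norm_mulmx _ _))// ler_wpM2r// ler_wpM2l//; exact: JM.
rewrite (le_trans (ler_normD _ _))// normrZ mulrDl mul1r lerD//; first exact: fM.
rewrite -[leRHS]mul1r ler_pM//; [exact: le_trans rho1|exact: ftM].
Qed.

(** The difference of two flows solves a linear equation forced by the differences of J, f and f_t
    ([affine_flow_sub]); these are Lipschitz, and [gronwall_small] concludes. *)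
Lemma phi_lip : exists2 P, 0 <= P & forall t y y' r, Tb t y -> Tb t y' -> `|r| <= rho ->
  `|phi t y' r - phi t y r| <= P * `|y' - y| * `|r|.
Proof.
have c0 : 0 <= d%:R * L * (4 * M) + 2 * L.
  have ML := mulr_ge0 (ltW L0) (ltW M0); have dML := mulr_ge0 (ler0n R d) ML.
  by rewrite addr_ge0 ?mulr_ge0// ltW.
exists (2 * (d%:R * L * (4 * M) + 2 * L)); first by rewrite mulr_ge0.
move=> t y y' r Ty Ty'; set N := `|y' - y|.
have N0 : 0 <= N by exact: normr_ge0.
rewrite -[2 * _ * N]mulrA.
pose w r := phi t y' r - phi t y r.
apply: (@gronwall_small _ _ w (fun r => J t y' *m w r +
   ((J t y' - J t y) *m phi t y r + (f t y' - f t y) + r *: (ft t y' - ft t y)))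
   _ _ _ _ _ dM0 _ rhoM) => [|u||u ur].
- by rewrite /w !phi0 subrr.
- have := deriv_onB (deriv_phi t y' setT u) (deriv_phi t y setT u).
  by rewrite affine_flow_sub.
- exact: mulr_ge0.
have u1 : `|u| <= 1 := le_trans ur rho1.
rewrite (le_trans (ler_normD _ _))// lerD//.
  rewrite (le_trans (mx_norm_mulmx _ _))// ler_wpM2r// ler_wpM2l//; exact: JM.
rewrite (le_trans (ler_normD _ _))// (le_trans (lerD (ler_normD _ _) (lexx _)))//.
have h1 : `|(J t y' - J t y) *m phi t y u| <= d%:R * L * (4 * M) * N.
  rewrite (le_trans (mx_norm_mulmx _ _))// -!mulrA ler_wpM2l//.
  have -> : L * (4 * (M * N)) = (L * N) * (4 * M) by ring.
  apply: ler_pM => //; first exact: JL.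
  apply: le_trans (phi_bound Ty ur) _.
  by rewrite ler_piMr// mulr_ge0// ltW.
have h2 : `|f t y' - f t y| <= L * N by exact: fL.
have h3 : `|u *: (ft t y' - ft t y)| <= L * N.
  by rewrite normrZ -[leRHS]mul1r ler_pM//; exact: ftL.
rewrite mulrDl; lra.
Qed.

(** A bound for q term by term: f at the stage argument, then J phi with |phi| <= 4 M, then f_t with
    |r| <= 1, then f at the base point. *)
Definition stage_bound : R := M + (d%:R * M * (4 * M) + M + M).

Lemma stage_bound_ge0 : 0 <= stage_bound.
Proof.
have MM := mulr_ge0 (ltW M0) (ltW M0); have dMM := mulr_ge0 (ler0n R d) MM.
have := M0; rewrite /stage_bound; lra.
Qed.

Definition cmax : R := \sum_i `|rk_c rk i|.
Definition amax : R := \sum_i \sum_j `|rk_a rk i j|.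
Definition bmax : R := \sum_i `|rk_b rk i|.

Lemma cmax_ge i : `|rk_c rk i| <= cmax.
Proof. by rewrite /cmax (bigD1 i)//= lerDl sumr_ge0. Qed.

Lemma amax_ge (i : 'I_s) : \sum_(j < s | (j < i)%N) `|rk_a rk i j| <= amax.
Proof.
apply: (@le_trans _ _ (\sum_j `|rk_a rk i j|)).
  by rewrite [leRHS](bigID (fun j : 'I_s => (j < i)%N))/= lerDl sumr_ge0.
have -> : amax = \sum_j `|rk_a rk i j| + \sum_(k | k != i) \sum_j `|rk_a rk k j|.
  by rewrite /amax (bigD1 i).
by rewrite lerDl; apply: sumr_ge0 => k _; exact: sumr_ge0.
Qed.

Lemma cmax_ge0 : 0 <= cmax. Proof. exact: sumr_ge0. Qed.
Lemma amax_ge0 : 0 <= amax. Proof. by apply: sumr_ge0 => i _; exact: sumr_ge0. Qed.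
Lemma bmax_ge0 : 0 <= bmax. Proof. exact: sumr_ge0. Qed.

(* Steps of length at most h1 keep all stages of the scheme inside the tube. *)
Variable h1 : R.
Hypothesis h10 : 0 < h1.
Hypothesis h1rho : h1 <= rho.
Hypothesis h1c : cmax * h1 <= rho.
Hypothesis h1ep : (5 * M * cmax + amax * stage_bound) * h1 <= ep / 2.

Let K t y del i := rk_stage rk (ll_q t0 T f t y) t 0 del i.
Let xi t y del (i : 'I_s) := del *: \sum_(j < s | (j < i)%N) rk_a rk i j *: K t y del j.
Let arg t y del (i : 'I_s) := y + phi t y (rk_c rk i * del) + xi t y del i.

Lemma stageE t y del i : K t y del i =
  f (t + rk_c rk i * del) (arg t y del i) - J t y *m phi t y (rk_c rk i * del)
    - (rk_c rk i * del) *: ft t y - f t y.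
Proof.
rewrite /K rk_stageE add0r /ll_q.
by have -> : t + rk_c rk i * del - t = rk_c rk i * del by ring.
Qed.

Lemma stage_time_small del i : 0 <= del <= h1 -> `|rk_c rk i * del| <= rho.
Proof.
move=> /andP[d0 dh]; rewrite normrM [`|del|]ger0_norm// (le_trans _ h1c)//.
by rewrite ler_pM// cmax_ge.
Qed.

Lemma stage_sum_bound (k : 'I_s -> 'cV[R]_d) (i : 'I_s) B :
  0 <= B -> (forall j : 'I_s, (j < i)%N -> `|k j| <= B) ->
  `|\sum_(j < s | (j < i)%N) rk_a rk i j *: k j| <= amax * B.
Proof.
move=> B0 kB; rewrite (le_trans (ler_norm_sum _ _ _))//.
apply: (@le_trans _ _ ((\sum_(j < s | (j < i)%N) `|rk_a rk i j|) * B)).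
  by rewrite mulr_suml ler_sum// => j ji; rewrite normrZ ler_wpM2l// kB.
by rewrite ler_wpM2r// amax_ge.
Qed.

(** Membership and size are proved together: bounded earlier stages keep the argument of stage i in
    the tube, which in turn bounds stage i. *)
Lemma stage_in t y del : t0 <= t <= T -> `|y - x t| <= ep / 2 -> 0 <= del <= h1 ->
  stage_times_in rk t0 T t del -> forall i,
  Tb (t + rk_c rk i * del) (arg t y del i) /\ `|K t y del i| <= stage_bound.
Proof.
move=> tT yx dh st; have Ty := tube_half tT yx; have [d0 d1] := andP dh.
suff H n : forall i : 'I_s, (i < n)%N ->
  Tb (t + rk_c rk i * del) (arg t y del i) /\ `|K t y del i| <= stage_bound.
  by move=> i; exact: (H s).
elim: n => // n IH i; rewrite ltnS => iN.
have cr := stage_time_small i dh.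
have Targ : Tb (t + rk_c rk i * del) (arg t y del i).
  split; first exact: st.
  have -> : arg t y del i - x (t + rk_c rk i * del) = (y - x t) +
     (phi t y (rk_c rk i * del) + xi t y del i - (x (t + rk_c rk i * del) - x t)).
    rewrite /arg; move: (phi _ _ _) (xi _ _ _ _) (x _) (x t) => A1 A2 A3 A4.
    by apply/colP => k; rewrite !mxE; ring.
  have X1 : `|xi t y del i| <= h1 * (amax * stage_bound).
    rewrite normrZ ger0_norm// ler_pM//; apply: stage_sum_bound; first exact: stage_bound_ge0.
    by move=> j ji; have [] := IH j (leq_trans ji iN).
  have X2 : `|rk_c rk i * del| <= cmax * h1.
    by rewrite normrM ler_pM ?cmax_ge// ger0_norm.
  have X3 := phi_bound Ty cr.
  have X4 : `|x (t + rk_c rk i * del) - x t| <= M * `|rk_c rk i * del|.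
    by have := x_lip tT (st i); rewrite [t + _ - t]addrAC subrr add0r.
  have X5 : M * `|rk_c rk i * del| <= M * (cmax * h1) by rewrite ler_wpM2l// ltW.
  apply: (le_trans (ler_normD _ _)).
  have X6 := ler_normB (phi t y (rk_c rk i * del) + xi t y del i)
    (x (t + rk_c rk i * del) - x t).
  have X7 := ler_normD (phi t y (rk_c rk i * del)) (xi t y del i).
  exact: (tube_budget yx X3 X1 X4 X5 h1ep X6 X7).
split=> //; rewrite stageE /stage_bound.
rewrite (le_trans (ler_normB _ _))// -/(_ + M) addrA lerD//; last exact: fM.
rewrite addrA (le_trans (ler_normB _ _))// lerD//; last first.
  by rewrite normrZ -[leRHS]mul1r ler_pM//; [exact: le_trans rho1|exact: ftM].
rewrite (le_trans (ler_normB _ _))// lerD//; first exact: fM.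
rewrite (le_trans (mx_norm_mulmx _ _))// ler_pM ?mulr_ge0//.
  by rewrite ler_wpM2l//; exact: JM.
apply: le_trans (phi_bound Ty cr) _; rewrite ler_piMr ?mulr_ge0 ?(ltW M0)//.
exact: le_trans rho1.
Qed.

(** The constant grows along the stages, each being built from the previous ones; hence an induction
    on the number of stages with the constant quantified inside. *)
Lemma stage_lip : exists2 KL, 0 <= KL & forall t y del, t0 <= t <= T ->
  `|y - x t| <= ep / 2 -> 0 <= del <= h1 -> stage_times_in rk t0 T t del ->
  forall i, `|K t y del i - K t (x t) del i| <= KL * `|y - x t|.
Proof.
suff H n : exists2 KL, 0 <= KL & forall t y del, t0 <= t <= T ->
  `|y - x t| <= ep / 2 -> 0 <= del <= h1 -> stage_times_in rk t0 T t del ->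
  forall i : 'I_s, (i < n)%N -> `|K t y del i - K t (x t) del i| <= KL * `|y - x t|.
  by have [KL KL0 HK] := H s; exists KL => // t y del tT yx dh st i; exact: HK.
elim: n => [|n [KL KL0 IH]]; first by exists 0.
have [P P0 HP] := phi_lip; have A0 := amax_ge0.
exists (KL + (L * (1 + P + h1 * (amax * KL)) + (d%:R * L * (4 * M)
   + d%:R * M * P) + L + L)).
  have L1 := ltW L0; have M1 := ltW M0; have h11 := ltW h10.
  by rewrite !(addr_ge0, mulr_ge0).
move=> t y del tT yx dh st i; rewrite ltnS => iN; have [d0 d1] := andP dh.
have xx : `|x t - x t| <= ep / 2 by rewrite subrr normr0 divr_ge0// ltW.
have [Ta _] := stage_in tT yx dh st i; have [Tx _] := stage_in tT xx dh st i.
have Ty := tube_half tT yx; have Txt := tube_x tT.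
have cr := stage_time_small i dh; have c1 := le_trans cr rho1.
set N := `|y - x t|; have N0 : 0 <= N by exact: normr_ge0.
set r := rk_c rk i * del in cr c1 Ta Tx *.
have PL : `|phi t y r - phi t (x t) r| <= P * N.
  apply: le_trans (HP _ _ _ _ Txt Ty cr) _; by rewrite ler_piMr// mulr_ge0.
have XL : `|xi t y del i - xi t (x t) del i| <= h1 * (amax * KL) * N.
  rewrite /xi -scalerBr normrZ ger0_norm// -mulrA ler_pM// -sumrB.
  under eq_bigr do rewrite -scalerBr.
  rewrite -mulrA; apply: stage_sum_bound; first exact: mulr_ge0.
  by move=> j ji; apply: IH => //; exact: leq_trans iN.
have AL : `|arg t y del i - arg t (x t) del i| <= (1 + P + h1 * (amax * KL)) * N.
  rewrite /arg !opprD (addrACA (y + _)) (addrACA y) (le_trans (ler_normD _ _))//.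
  by rewrite !mulrDl mul1r lerD// (le_trans (ler_normD _ _))// lerD.
have FL : `|f (t + r) (arg t y del i) - f (t + r) (arg t (x t) del i)| <=
   L * (1 + P + h1 * (amax * KL)) * N.
  by apply: le_trans (fL Tx Ta) _; rewrite -mulrA ler_wpM2l// ltW.
have JPL : `|J t y *m phi t y r - J t (x t) *m phi t (x t) r| <=
   (d%:R * L * (4 * M) + d%:R * M * P) * N.
  rewrite mulmx_sub_split.
  rewrite (le_trans (ler_normD _ _))// mulrDl lerD//.
    rewrite (le_trans (mx_norm_mulmx _ _))// -!mulrA ler_wpM2l//.
    have -> : L * (4 * (M * N)) = (L * N) * (4 * M) by ring.
    apply: ler_pM => //; first exact: JL.
    by apply: le_trans (phi_bound Txt cr) _; rewrite ler_piMr// mulr_ge0// ltW.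
  rewrite (le_trans (mx_norm_mulmx _ _))// -!mulrA ler_wpM2l// ler_pM//.
  exact: JM.
have FTL : `|r *: ft t y - r *: ft t (x t)| <= L * N.
  by rewrite -scalerBr normrZ -[leRHS]mul1r ler_pM//; exact: ftL.
have F0L : `|f t y - f t (x t)| <= L * N by exact: fL.
rewrite !stageE -/r.
rewrite subr4; have KN : 0 <= KL * N := mulr_ge0 KL0 N0.
exact: (stage_lip_budget KN FL JPL FTL F0L).
Qed.

(** The factor [del] comes from [phi_lip] and from the step length in front of the Runge-Kutta sum;
    thanks to it one step amplifies errors by at most 1 + KL del. *)
Lemma increment_lip : exists2 KL, 0 <= KL & forall t y del, t0 <= t <= T ->
  `|y - x t| <= ep / 2 -> 0 <= del <= h1 -> stage_times_in rk t0 T t del ->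
  `|(phi t y del + llrk_rho t0 T f rk t y del) -
    (phi t (x t) del + llrk_rho t0 T f rk t (x t) del)| <= KL * del * `|y - x t|.
Proof.
have [KL KL0 HK] := stage_lip; have [P P0 HP] := phi_lip; exists (P + bmax * KL).
  by rewrite addr_ge0 ?mulr_ge0// bmax_ge0.
move=> t y del tT yx dh st; have [d0 d1] := andP dh.
rewrite opprD addrACA (le_trans (ler_normD _ _))// !mulrDl lerD//.
  have := HP _ _ _ del (tube_x tT) (tube_half tT yx).
  by rewrite ger0_norm// mulrAC; apply; exact: le_trans h1rho.
rewrite /llrk_rho /rk_increment -scalerBr normrZ ger0_norm// mulrAC [_ * del]mulrC ler_wpM2l//.
rewrite -sumrB (le_trans (ler_norm_sum _ _ _))// -mulrA mulr_suml ler_sum// => j _.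
by rewrite -scalerBr normrZ ler_wpM2l//; exact: HK.
Qed.

(** * Local error, uniform in the starting time *)

Variable gamma : nat.
Hypothesis rkO : rk_order rk gamma.
Hypothesis fC : Cb (tube t0 T x ep) gamma.+1 (fun _ => f).

Let err tau r := x (tau + r) - x tau -
  (phi tau (x tau) r + llrk_rho t0 T f rk tau (x tau) r).

Lemma phi_le t y r : Tb t y -> `|r| <= rho -> `|phi t y r| <= 4 * M.
Proof.
move=> Ty rr; apply: le_trans (phi_bound Ty rr) _.
by rewrite ler_piMr ?mulr_ge0 ?(ltW M0)//; exact: le_trans rho1.
Qed.

Let E := [set v : 'cV[R]_d | `|v| < ep / 2].

Lemma open_E : open E.
Proof.
rewrite (_ : E = ball (0 : 'cV[R]_d) (ep / 2)); first exact: ball_open.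
by apply/seteqP; split=> v; rewrite -ball_normE /ball_ /E /= sub0r normrN.
Qed.

(** The argument of [f] stays in the tube: half the radius is left to the space variable, and phi -
    (x(t) - x(tau)), of size at most 5 M |t - tau|, uses the other half. *)
Lemma ll_q_Cb tau a b : t0 <= tau <= T -> t0 <= a -> b <= T ->
  (forall t, a <= t <= b -> `|t - tau| <= rho /\ 5 * M * `|t - tau| <= ep / 2) ->
  Cb (cyl a b E) gamma.+1 (fun _ => ll_q t0 T f tau (x tau)).
Proof.
move=> tT t0a bT Hab; have Tx := tube_x tT.
have inT t : a <= t <= b -> t0 <= t <= T.
  by move=> /andP[h h']; rewrite (le_trans t0a)// (le_trans h').
pose W := `|t0| + `|T| + 4 * M + ep.
have W4 : 4 * M <= W by rewrite /W addrAC lerDr !addr_ge0// ltW.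
have WM : M <= W by apply: le_trans W4; have := M0; lra.
have MM := M0; have ee := ep0.
have Wt t : t0 <= t <= T -> `|t| <= W.
  move=> /andP[h h']; rewrite ler_norml; have := ler_norm (- t0); have := ler_norm T.
  by rewrite normrN /W; have := normr_ge0 T; have := normr_ge0 t0; lra.
have CP k : Cb (cyl a b E) k (fun _ t _ => phi tau (x tau) (t - tau)).
  apply: (Cb_ext (F := fun _ t _ => linear_flow (J tau (x tau)) (f tau (x tau)) (ft tau (x tau))
    (1 * t + - tau))) => [c t y _|]; first by rewrite mul1r.
  apply: (@linear_flow_Cb _ unit d d (cyl a b E) (fun _ => J tau (x tau)) (fun _ => f tau (x tau))
    (fun _ => ft tau (x tau)) 1 (fun _ => - tau) W k) => c t y [tab _]; split; [split|].
  - by apply: le_trans WM; exact: JM.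
  - by apply: le_trans WM; exact: fM.
  - by apply: le_trans WM; exact: ftM.
  - exact/Wt/inT.
  - by rewrite normrN; exact: Wt.
  - by rewrite mul1r; apply: le_trans W4; apply: phi_le => //; have [] := Hab t tab.
have cst (v : 'cV[R]_d) : Cb (cyl a b E) gamma.+1 (fun _ _ _ => v).
  by apply: (Cb_cst _ (a := fun=> v) (M := `|v|)).
have ctime : Cb (cyl a b E) gamma.+1 (fun _ t _ => t).
  by apply: (Cb_time _ (M := W)) => c t y [tab _]; exact/Wt/inT.
have cspace : Cb (cyl a b E) gamma.+1 (fun _ _ y => y).
  by apply: (Cb_space _ (M := ep / 2)) => c t y [_ /ltW].
have c2 : Cb (cyl a b E) gamma.+1 (fun _ t _ => J tau (x tau) *m phi tau (x tau) (t - tau)).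
  by apply: (Cb_mulmx (A := fun _ => J tau (x tau)) (M := M) _ (CP _)) => *; exact: JM.
have c3 : Cb (cyl a b E) gamma.+1 (fun _ t _ => (t - tau) *: ft tau (x tau)).
  apply: CbZ (cst _); apply: CbB ctime _.
  exact: (Cb_cst _ (a := fun=> tau) (M := `|tau|)).
suff c1 : Cb (cyl a b E) gamma.+1 (fun _ t y => f t (x tau + phi tau (x tau) (t - tau) + y)).
  exact: CbB (CbB (CbB c1 c2) c3) (cst _).
apply: (Cb_comp (P := tube t0 T x ep) (sg := fun=> tt) _ fC ctime (CbD (CbD (cst _) (CP _)) cspace)).
move=> c t y [tab yE]; split; first exact: inT.
have [r1 r2] := Hab t tab.
have X := x_lip tT (inT t tab); have P := phi_bound Tx r1.
rewrite deviation_split.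
apply: (le_trans (ler_normD _ _)).
have := ler_normB (phi tau (x tau) (t - tau)) (x t - x tau).
move: yE; rewrite /E /=; lra.
Qed.

(* x - x(tau) - phi solves the auxiliary problem exactly; the local error of the LLRK
   step is therefore the Runge-Kutta local error for that problem. *)
Lemma aux_solution tau b : t0 <= tau -> b <= T ->
  (forall t, tau <= t <= b -> `|t - tau| <= rho /\ 5 * M * `|t - tau| < ep / 2) ->
  ode_solution tau b E (ll_q t0 T f tau (x tau))
    (fun t => x t - x tau - phi tau (x tau) (t - tau)).
Proof.
move=> t0t bT Hb t tb; have [tt tb'] := andP tb.
have tT : t0 <= t <= T by rewrite (le_trans t0t)//= (le_trans tb').
have tauT : t0 <= tau <= T by rewrite t0t (le_trans tt)// (le_trans tb').
have Tx := tube_x tauT; have [r1 r2] := Hb t tb; split.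
  have X := x_lip tauT tT; have P := phi_bound Tx r1.
  have := ler_normB (x t - x tau) (phi tau (x tau) (t - tau)).
  rewrite /E /=; lra.
apply/is_derive_inP.
have -> : ll_q t0 T f tau (x tau) t (x t - x tau - phi tau (x tau) (t - tau)) =
  f t (x t) - 0 - (J tau (x tau) *m phi tau (x tau) (t - tau) + f tau (x tau)
     + (t - tau) *: ft tau (x tau)).
  rewrite /ll_q subr0.
  by rewrite deviation_cancel residual_regroup.
apply: deriv_onB; first apply: deriv_onB; last 2 first.
- exact: deriv_on_cst.
- by apply: (deriv_on_translate (A := setT)) => //; exact: deriv_phi.
apply: deriv_on_sub (xsol tT) => u /= /andP[h h'].
by rewrite (le_trans t0t)// (le_trans h').
Qed.

(* The auxiliary vector field is only defined near (tau, 0), so the order condition is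
   applied on the time window [tau - eta, tau + eta] and a small ball. *)
Lemma rk_pointwise tau : t0 <= tau < T -> exists KK del, 0 < del /\ forall r, 0 < r < del ->
  tau + r <= T -> stage_times_in rk t0 T tau r -> `|err tau r| <= KK * r ^+ gamma.+1.
Proof.
move=> /andP[t0t tT]; have M1 := M0; have e1 := ep0; have rr := rho0.
(* The condition leaves 5 M |t - tau| <= ep / 4, strictly below the radius [ep / 2] of the open ball
   [E]. *)
have [eta [eta0 eta1 eta2]] : exists eta, [/\ 0 < eta, eta <= rho & eta * (20 * M) <= ep].
  have M20 : 0 < 20 * M by rewrite mulr_gt0.
  exists (Num.min rho (ep / (20 * M))); split; first by rewrite lt_min rho0 divr_gt0.
    by rewrite ge_min lexx.
  by rewrite -ler_pdivlMr// ge_min lexx orbT.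
pose a := Num.max t0 (tau - eta); pose b := Num.min T (tau + eta).
have a1 : t0 <= a by rewrite le_max lexx.
have a2 : tau - eta <= a by rewrite le_max lexx orbT.
have a3 : a <= tau by rewrite ge_max t0t; lra.
have b1 : b <= T by rewrite ge_min lexx.
have b2 : b <= tau + eta by rewrite ge_min lexx orbT.
have b3 : tau < b by rewrite lt_min tT; lra.
have Hab t : a <= t <= b -> `|t - tau| <= eta.
  by move=> /andP[h h']; rewrite ler_norml; lra.
have Hep t : a <= t <= b -> 5 * M * `|t - tau| < ep / 2.
  move=> /Hab h; have : 20 * M * `|t - tau| <= 20 * M * eta by rewrite ler_wpM2l// mulr_ge0// ltW.
  rewrite [20 * M * eta]mulrC => h'; lra.
have qC : Ck gamma.+1 a b E (ll_q t0 T f tau (x tau)).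
  apply: Cb_Ck; [by lra|exact: open_E|]; apply: ll_q_Cb => //; first by rewrite t0t ltW.
  by move=> t tab; split; [exact: le_trans (Hab t tab) _|exact/ltW/Hep].
have Hb t : tau <= t <= b -> `|t - tau| <= rho /\ 5 * M * `|t - tau| < ep / 2.
  move=> /andP[h h']; have tab : a <= t <= b by rewrite (le_trans a3).
  by split; [exact: le_trans (Hab t tab) _|exact: Hep].
have atb : a <= tau < b by rewrite a3.
have [KK [del [del0 HK]]] := rkO open_E qC atb (aux_solution t0t b1 Hb).
have c1 : 0 < cmax + 1 by have := cmax_ge0; lra.
(* The bound [eta / (cmax + 1)] puts the stage times in the window around tau on which the order
   condition is invoked. *)
exists KK, (Num.min del (Num.min eta (eta / (cmax + 1)))); split.
  by rewrite !lt_min del0 eta0 divr_gt0.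
move=> r; rewrite !lt_min => /andP[r0 /andP[rd /andP[reta rc]]] rT st.
have E1 : tau + r - tau = r by rewrite addrAC subrr add0r.
have U0 : x tau - x tau - phi tau (x tau) (tau - tau) = 0.
  by rewrite (subrr tau) phi0 (subrr (x tau)) (subrr (0 : 'cV[R]_d)).
move: (HK r) => {HK}; rewrite U0 E1 increment_regroup => HK.
apply: HK; first by rewrite r0.
  by rewrite le_min rT lerD2l ltW.
move=> i; have /andP[s1 s2] := st i.
have ci : `|rk_c rk i * r| <= eta.
  rewrite normrM (gtr0_norm r0); move: rc; rewrite ltr_pdivlMr// => /ltW; apply: le_trans.
  rewrite mulrC ler_wpM2l ?(ltW r0)// (le_trans (cmax_ge i))// lerDl//.
move: ci; rewrite ler_norml => /andP[ci1 ci2].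
rewrite ge_max le_min s1 s2 /=; lra.
Qed.

(** The index of the family holds the starting time and the full step h, whose stage times lie in
    [t0, T]; the variable of the family is a step r in [0, h]. *)
Definition admissible (c : R * R) :=
  [/\ t0 <= c.1, 0 < c.2, c.2 <= h1, c.1 + c.2 <= T & stage_times_in rk t0 T c.1 c.2].

Let C := {c : R * R | admissible c}.
Let tau (c : C) := (sval c).1.
Let O (c : C) (r : R) (_ : 'cV[R]_0) : Prop := 0 <= r <= (sval c).2.

(** Whatever the sign of c_i, tau + c_i r lies between tau and tau + c_i h, both in [t0, T]. *)
Lemma admissible_between (c : C) r : 0 <= r <= (sval c).2 ->
  [/\ t0 <= tau c <= T, t0 <= tau c + r <= T, 0 <= r <= h1 & stage_times_in rk t0 T (tau c) r].
Proof.
case: c => [[tc h]] [/= t0c h0 hh cT st]; rewrite /tau /= => /andP[r0 rh].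
split; [lra|lra|lra|] => i; have /andP[s1 s2] := st i.
have [c0|c0] := leP 0 (rk_c rk i).
  have := ler_wpM2l c0 rh; have := mulr_ge0 c0 r0; lra.
have := ler_wnM2l (ltW c0) rh; have := mulr_le0_ge0 (ltW c0) r0; lra.
Qed.

Hypothesis t0T : t0 <= T.

(** Bootstrap on x' = f(t, x): class [k] of x gives class [k] of f along x by [Cb_comp], hence class
    [k.+1] of x by [Cb_curve]. *)
Lemma x_Cb k : (k <= gamma.+1)%N -> Cb O k (fun c r _ => x (tau c + r)).
Proof.
pose X := `|x t0| + M * (T - t0); pose B c := [set r | t0 <= tau c + r <= T].
have xX t : t0 <= t <= T -> `|x t| <= X.
  move=> tT; have := x_lip (_ : t0 <= t0 <= T) tT; rewrite lexx t0T => /(_ isT) h.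
  have := ler_normD (x t - x t0) (x t0); rewrite subrK /X => h'.
  have : M * `|t - t0| <= M * (T - t0).
    by rewrite ler_wpM2l ?(ltW M0)// ger0_norm; lra.
  lra.
have OB c r y : O c r y -> B c r by move=> /admissible_between[].
have dx c r y : O c r y -> deriv_on (B c) (fun r => x (tau c + r)) r (f (tau c + r) (x (tau c + r))).
  move=> /admissible_between[_ rT _ _].
  rewrite [tau c + r]addrC in rT *.
  have := @deriv_on_translate _ _ [set s | t0 <= s <= T] (B c) x r (tau c) _ _ (xsol rT).
  move=> H; apply: deriv_on_ext (H _) => [|u _|u]; first by rewrite /B /= addrC.
    by rewrite addrC.
  by rewrite /B /= addrC.
have bX c r y : O c r y -> `|x (tau c + r)| <= X by move=> /admissible_between[_ rT _ _]; exact: xX.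
elim: k => [_|k IH kg].
  by apply: (Cb_curve0 (B := B) (M := X) (H := fun c r => f (tau c + r) (x (tau c + r)))).
apply: (Cb_curve (B := B) (M := X) (H := fun c r => f (tau c + r) (x (tau c + r)))) => //.
apply: (Cb_comp (P := tube t0 T x ep) (sg := fun=> tt) (g := fun c r _ => tau c + r) _
  (Cb_le (ltnW kg) fC)) (IH (ltnW kg)).
  by move=> c r y /admissible_between[_ rT _ _]; exact: tube_x.
apply: CbD.
  apply: (Cb_cst _ (M := `|t0| + `|T|)) => c r y /admissible_between[cT _ _ _].
  rewrite ler_norml; have := ler_norm (- t0); have := ler_norm T.
  by rewrite normrN; have := normr_ge0 T; have := normr_ge0 t0; lra.
apply: (Cb_time _ (M := h1)) => c r y /admissible_between[_ _ rh _].
by rewrite ger0_norm; lra.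
Qed.

Lemma tube_tau (c : C) r y : O c r y -> Tb (tau c) (x (tau c)).
Proof. by move=> /admissible_between[cT _ _ _]; exact: tube_x. Qed.

Lemma tau_Cb : Cb O gamma.+1 (fun c _ _ => tau c).
Proof.
apply: (Cb_cst _ (M := `|t0| + `|T|)) => c r y /admissible_between[cT _ _ _].
rewrite ler_norml; have := ler_norm (- t0); have := ler_norm T.
by rewrite normrN; have := normr_ge0 T; have := normr_ge0 t0; lra.
Qed.

Lemma step_Cb : Cb O gamma.+1 (fun _ r _ => r).
Proof.
apply: (Cb_time _ (M := h1)) => c r y /admissible_between[_ _ /andP[r0 r1] _].
by rewrite ger0_norm.
Qed.

Lemma x_tau_Cb : Cb O gamma.+1 (fun c _ _ => x (tau c)).
Proof.
have [X X0 HX] := Cb_bound (x_Cb (leqnn gamma.+1)).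
apply: (Cb_cst _ (M := X)) => c r y Or; have := HX c 0 y; rewrite addr0; apply.
by move: Or; rewrite /O => /andP[r0 rh]; rewrite lexx (le_trans r0).
Qed.

Lemma phi_Cb ka : `|ka| * h1 <= rho ->
  Cb O gamma.+1 (fun c r _ => phi (tau c) (x (tau c)) (ka * r)).
Proof.
move=> kh; have MM := M0; pose W : R := 4 * M + 1.
have WM : M <= W by rewrite /W; lra.
apply: (Cb_ext (F := fun c r _ => linear_flow (J (tau c) (x (tau c)))
  (f (tau c) (x (tau c))) (ft (tau c) (x (tau c))) (ka * r + 0))) => [c r y _|].
  by rewrite addr0.
apply: (@linear_flow_Cb _ C 0 d O (fun c => J (tau c) (x (tau c)))
  (fun c => f (tau c) (x (tau c))) (fun c => ft (tau c) (x (tau c))) ka (fun _ => 0) W).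
move=> c r y Or; have [_ _ /andP[r0 r1] _] := admissible_between Or.
split; [split|].
- by apply: le_trans WM; exact: JM (tube_tau Or).
- by apply: le_trans WM; exact: fM (tube_tau Or).
- by apply: le_trans WM; exact: ftM (tube_tau Or).
- by rewrite ger0_norm// /W; have := h1rho; have := rho1; lra.
- by rewrite normr0 /W; lra.
- rewrite addr0; apply: (@le_trans _ _ (4 * M)); last by rewrite lerDl.
  apply: phi_le (tube_tau Or) _; rewrite normrM (ger0_norm r0).
  by apply: le_trans kh; rewrite ler_wpM2l.
Qed.

(** Induction on the stage: each is built from [f] composed with earlier stages, and [stage_in]
    keeps the composite where the derivatives of [f] are bounded. *)
Lemma stage_Cb i : Cb O gamma.+1 (fun c r _ => K (tau c) (x (tau c)) r i).
Proof.
have cf : Cb O gamma.+1 (fun c _ _ => f (tau c) (x (tau c))).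
  by apply: (Cb_cst _ (M := M)) => c r y Or; exact: fM (tube_tau Or).
have cft : Cb O gamma.+1 (fun c _ _ => ft (tau c) (x (tau c))).
  by apply: (Cb_cst _ (M := M)) => c r y Or; exact: ftM (tube_tau Or).
suff H n : forall i : 'I_s, (i < n)%N -> Cb O gamma.+1 (fun c r _ => K (tau c) (x (tau c)) r i).
  exact: (H s).
elim: n => [i0 |n IH {}i]; first by rewrite ltn0.
rewrite ltnS => iN; set ka := rk_c rk i.
have kh : `|ka| * h1 <= rho.
  by apply: le_trans h1c; rewrite ler_wpM2r ?(ltW h10)//; exact: cmax_ge.
have cs : Cb O gamma.+1 (fun _ r _ => ka * r) by exact: (Cb_scale ka step_Cb).
have cxi : Cb O gamma.+1 (fun c r _ => xi (tau c) (x (tau c)) r i).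
  apply: (CbZ step_Cb); apply: Cb_sum => j ji; apply: Cb_scale.
  by apply: IH; exact: leq_trans iN.
have carg : Cb O gamma.+1 (fun c r _ => arg (tau c) (x (tau c)) r i).
  exact: CbD (CbD x_tau_Cb (phi_Cb kh)) cxi.
have c1 : Cb O gamma.+1 (fun c r _ => f (tau c + ka * r) (arg (tau c) (x (tau c)) r i)).
  apply: (Cb_comp (P := tube t0 T x ep) (sg := fun=> tt) (g := fun c r _ => tau c + ka * r)
    _ fC (CbD tau_Cb cs) carg).
  move=> c r y Or; have [cT _ rh st] := admissible_between Or.
  have xx : `|x (tau c) - x (tau c)| <= ep / 2 by rewrite subrr normr0 divr_ge0// ltW.
  by have [] := stage_in cT xx rh st i.
have c2 : Cb O gamma.+1 (fun c r _ => J (tau c) (x (tau c)) *m phi (tau c) (x (tau c)) (ka * r)).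
  apply: (Cb_mulmx (A := fun c => J (tau c) (x (tau c))) (M := M) _ (phi_Cb kh)).
  by move=> c r y Or; exact: JM (tube_tau Or).
apply: Cb_ext (CbB (CbB (CbB c1 c2) (CbZ cs cft)) cf) => c r y _.
by rewrite stageE.
Qed.

Lemma err_Cb : Cb O gamma.+1 (fun c r _ => err (tau c) r).
Proof.
have CP : Cb O gamma.+1 (fun c r _ => phi (tau c) (x (tau c)) r).
  apply: (Cb_ext (F := fun c r _ => phi (tau c) (x (tau c)) (1 * r))) => [c r y _|].
    by rewrite mul1r.
  by apply: phi_Cb; rewrite normr1 mul1r.
have crho : Cb O gamma.+1 (fun c r _ => llrk_rho t0 T f rk (tau c) (x (tau c)) r).
  apply: (CbZ step_Cb); apply: Cb_sum => j _; apply: Cb_scale; exact: stage_Cb.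
exact: CbB (CbB (x_Cb (leqnn gamma.+1)) x_tau_Cb) (CbD CP crho).
Qed.

Lemma local_error : exists2 Cl, 0 <= Cl & forall tc h, admissible (tc, h) ->
  `|x (tc + h) - x tc - (phi tc (x tc) h + llrk_rho t0 T f rk tc (x tc) h)| <=
    Cl * h ^+ gamma.+1.
Proof.
have [c r rh||Cl [Cl0 HCl]] := @Cb_flat _ C 0 _ O (fun c => (sval c).2) _ gamma.+1 _ err_Cb.
- exact: rh.
- move=> c h0; have [H1 H2 H3 H4 H5] := svalP c.
  (* The order condition excludes starting at T; a positive step ending before T provides the strict
     inequality. *)
  have tT : t0 <= tau c < T by rewrite /tau H1 (lt_le_trans _ H4)// ltrDl.
  have [KK [del [del0 HK]]] := rk_pointwise tT; exists KK, del; split=> // r rd rh.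
  have /admissible_between[_ /andP[_ rT] _ st] : 0 <= r <= (sval c).2.
    by rewrite rh andbT ltW//; case/andP: rd.
  exact: HK.
exists Cl => // tc h adm; have [_ h0 _ _ _] := adm.
by have := HCl (exist _ (tc, h) adm) h; rewrite /= h0 lexx; exact.
Qed.

(** * Global error *)

Lemma convergence : (0 < gamma)%N -> exists C1 C2 h0 : R, [/\ 0 < C1, 0 < C2, 0 < h0 &
  forall h, 0 < h < 1 -> h < h0 -> forall N t, time_partition t0 T h N t ->
    (forall n, (n <= N)%N -> t n + h <= T -> stage_times_in rk t0 T (t n) h ->
      `|x (t n + h) - x (t n) - h *: llrk_phi t0 T f rk (t n) (x (t n)) h|
        <= C1 * h ^+ gamma.+1) /\
    (forall y : nat -> 'cV[R]_d,
      (forall n, (n < N)%N -> stage_times_in rk t0 T (t n) (t n.+1 - t n)) ->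
      y 0%N = x t0 ->
      (forall n, (n < N)%N -> y n.+1 = y n + (t n.+1 - t n) *:
        llrk_phi t0 T f rk (t n) (y n) (t n.+1 - t n)) ->
      forall n, (n < N)%N -> `|x (t n.+1) - y n.+1| <= C2 * h ^+ gamma)].
Proof.
move=> g0; have [Cl Cl0 HCl] := local_error; have [KL KL0 HKL] := increment_lip.
(* The Gronwall majorant at T divided by h^gamma; the added 1 makes it positive. *)
pose C2 := Cl * (T - t0) * expR (KL * (T - t0)) + 1.
have TT : 0 <= T - t0 by rewrite subr_ge0.
have C20 : 0 < C2 by rewrite ltr_wpDl// !mulr_ge0// expR_ge0.
(* Below [h1] the stage estimates hold; below [ep / (2 * C2)], as h < 1 and gamma >= 1, C2 h^gamma
   <= C2 h <= ep / 2 and the numerical solution stays in the half tube. *)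
exists (Cl + 1), C2, (Num.min h1 (ep / (2 * C2))).
split=> //; [by rewrite ltr_wpDl|by rewrite lt_min h10 divr_gt0// mulr_gt0|].
move=> h /andP[h0 hl1]; move=> /[dup] hep; rewrite lt_min => /andP[hh1 _] N t [t00 tN tS].
have tT := partition_range (fun n nN => ltW (proj1 (tS n nN))); rewrite t00 tN in tT.
have llE tc y del : 0 < del -> del *: llrk_phi t0 T f rk tc y del =
    phi tc y del + llrk_rho t0 T f rk tc y del.
  by move=> d0; rewrite /llrk_phi scalerA divff ?gt_eqF// scale1r.
have hg0 : 0 <= h ^+ gamma by rewrite exprn_ge0 ?ltW.
have C2h : C2 * h ^+ gamma <= ep / 2.
  apply: (@le_trans _ _ (C2 * h)).
    by rewrite ler_wpM2l ?(ltW C20)// -(prednK g0) exprS ger_pMr// exprn_ile1// ltW.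
  move: hep; rewrite lt_min => /andP[_]; rewrite ltr_pdivlMr ?mulr_gt0//.
  by have := ep0; lra.
split=> [n nN nh st|y st y0 yS n nN].
  rewrite llE//; apply: le_trans (HCl (t n) h _) _.
    by split=> //=; [case/andP: (tT n nN)|exact: ltW].
  by rewrite ler_wpM2r ?exprn_ge0 ?lerDl ?ltW.
apply: (@discrete_gronwall _ t (fun n => `|x (t n) - y n|) N KL (Cl * h ^+ gamma)) => //.
- exact: mulr_ge0.
- by rewrite t00 y0 subrr normr0.
- by move=> k kN; apply/ltW; have [] := tS k kN.
- rewrite t00 tN mulrAC ler_wpM2r//.
  by rewrite mulrA lerDl.
move=> k kN xyB; have [tk th] := tS k kN.
have kT := tT k (ltnW kN); have k1T := tT k.+1 kN; have stk := st k kN.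
have tE : t k + (t k.+1 - t k) = t k.+1 by rewrite addrC subrK.
have d0 : 0 < t k.+1 - t k by rewrite subr_gt0.
rewrite yS// llE//; move: (t k.+1 - t k) d0 tE th stk => del d0 tE th stk.
rewrite -tE in k1T *.
have dh : 0 <= del <= h1 by rewrite ltW//= (le_trans th) ?ltW.
have yx : `|y k - x (t k)| <= ep / 2 by rewrite distrC (le_trans xyB).
(* One factor [del] is kept apart from h^gamma, so that adding up local errors costs T - t0 and not
   the number of steps. *)
have e1 : `|x (t k + del) - x (t k) - (phi (t k) (x (t k)) del +
     llrk_rho t0 T f rk (t k) (x (t k)) del)| <= Cl * h ^+ gamma * del.
  apply: le_trans (HCl (t k) del _) _.
    by split=> //=; [case/andP: kT|case/andP: dh|case/andP: k1T].
  rewrite exprSr mulrA ler_wpM2r ?(ltW d0)// ler_wpM2l//.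
  by apply: lerXn2r => //; rewrite nnegrE ltW.
have := HKL _ _ _ kT yx dh stk; rewrite [`|y k - _|]distrC => e2.
exact: step_bound e1 e2.
Qed.

End LocalLinearization.

(** * Choice of the constants and conclusion *)

Lemma convergence_along (R : realType) (d : nat) (t0 T : R) (D : set 'cV[R]_d)
    (f : R -> 'cV[R]_d -> 'cV[R]_d) (gamma s : nat) (rk : rk_tableau R s) x :
  t0 < T -> open D -> (0 < gamma)%N -> rk_order rk gamma -> Ck gamma.+1 t0 T D f ->
  ode_solution t0 T D f x ->
  exists C1 C2 h0 : R, [/\ 0 < C1, 0 < C2, 0 < h0 &
  forall h, 0 < h < 1 -> h < h0 -> forall N t, time_partition t0 T h N t ->
    (forall n, (n <= N)%N -> t n + h <= T -> stage_times_in rk t0 T (t n) h ->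
      `|x (t n + h) - x (t n) - h *: llrk_phi t0 T f rk (t n) (x (t n)) h|
        <= C1 * h ^+ gamma.+1) /\
    (forall y : nat -> 'cV[R]_d,
      (forall n, (n < N)%N -> stage_times_in rk t0 T (t n) (t n.+1 - t n)) ->
      y 0%N = x t0 ->
      (forall n, (n < N)%N -> y n.+1 = y n + (t n.+1 - t n) *:
        llrk_phi t0 T f rk (t n) (y n) (t n.+1 - t n)) ->
      forall n, (n < N)%N -> `|x (t n.+1) - y n.+1| <= C2 * h ^+ gamma)].
Proof.
move=> t0T oD g0 rkO fCk sol.
have xD t : t0 <= t <= T -> D (x t) by move=> /sol[].
have xsol t : t0 <= t <= T -> deriv_on [set s | t0 <= s <= T] x t (f t (x t)).
  by move=> /sol[_ /is_derive_inP].
have xc t : t0 <= t <= T -> forall e, 0 < e -> exists2 eta, 0 < eta &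
    forall s, t0 <= s <= T -> `|s - t| < eta -> `|x s - x t| < e.
  by move=> /xsol/deriv_on_cont.
have [_ [_ Ht Hx]] : _ /\ [/\ _, Ck gamma t0 T D (partial_t t0 T f) &
  forall i, Ck gamma t0 T D (partial_x i f)] := fCk.
have NX : \forall n \near \oo, forall i, Cb (tube t0 T x n.+1%:R^-1) gamma (fun _ => partial_x i f).
  by apply: filter_forall => i; exact: (Ck_tube xc oD xD (Hx i)).
(* One radius serves [f] and all its first partial derivatives, each fact holding for all large
   [n]. *)
have [n [Cf [Ct Cx]]] := filter_ex
  (filterI (Ck_tube xc oD xD fCk) (filterI (Ck_tube xc oD xD Ht) NX)).
set ep := n.+1%:R^-1 in Cf Ct Cx; have ep0 : 0 < ep by rewrite invr_gt0.
have [Mf Mf0 HMf] := Cb_bound Cf; have [Mt Mt0 HMt] := Cb_bound Ct.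
have /choice[Mx HMx] : forall i, exists M, 0 < M /\ forall c t y,
    tube t0 T x ep c t y -> `|partial_x i f t y| <= M.
  by move=> i; have [M M0 HM] := Cb_bound (Cx i); exists M.
(* The partial derivatives are of class gamma only; gamma >= 1 leaves the derivative that [Cb_lip]
   consumes. *)
rewrite -(prednK g0) in Ct Cx.
have [Lf Lf0 HLf] := Cb_lip Cf; have [Lt Lt0 HLt] := Cb_lip Ct.
have /choice[Lx HLx] : forall i, exists L, 0 < L /\ forall t y y', tube t0 T x ep tt t y ->
    tube t0 T x ep tt t y' -> `|partial_x i f t y' - partial_x i f t y| <= L * `|y' - y|.
  by move=> i; have [L L0 HL] := Cb_lip (Cx i); exists L.
have SM : 0 <= \sum_i Mx i by apply: sumr_ge0 => i _; have [/ltW] := HMx i.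
have SL : 0 <= \sum_i Lx i by apply: sumr_ge0 => i _; have [/ltW] := HLx i.
have le_Mx i : Mx i <= \sum_i Mx i.
  by rewrite (bigD1 i)//= lerDl sumr_ge0// => j _; have [/ltW] := HMx j.
have le_Lx i : Lx i <= \sum_i Lx i.
  by rewrite (bigD1 i)//= lerDl sumr_ge0// => j _; have [/ltW] := HLx j.
pose M := Mf + Mt + \sum_i Mx i; pose L := Lf + Lt + \sum_i Lx i.
have M0 : 0 < M by rewrite /M; lra.
have L0 : 0 < L by rewrite /L; lra.
have fM t y : tube t0 T x ep tt t y -> `|f t y| <= M.
  by move=> /HMf /le_trans; apply; rewrite /M; lra.
have ftM t y : tube t0 T x ep tt t y -> `|partial_t t0 T f t y| <= M.
  by move=> /HMt /le_trans; apply; rewrite /M; lra.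
have JM t y : tube t0 T x ep tt t y -> `|jacobian_x f t y| <= M.
  move=> Ty; apply: mx_norm_le => [|i j]; first exact: ltW.
  rewrite mxE (le_trans (mx_norm_ge _ _ _))//; have [_ H] := HMx j.
  by rewrite (le_trans (H tt t y Ty))// (le_trans (le_Mx j))// /M; lra.
have fL t y y' : tube t0 T x ep tt t y -> tube t0 T x ep tt t y' ->
    `|f t y' - f t y| <= L * `|y' - y|.
  by move=> Ty Ty'; rewrite (le_trans (HLf _ _ _ Ty Ty'))// ler_wpM2r// /L; lra.
have ftL t y y' : tube t0 T x ep tt t y -> tube t0 T x ep tt t y' ->
    `|partial_t t0 T f t y' - partial_t t0 T f t y| <= L * `|y' - y|.
  by move=> Ty Ty'; rewrite (le_trans (HLt _ _ _ Ty Ty'))// ler_wpM2r// /L; lra.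
have JL t y y' : tube t0 T x ep tt t y -> tube t0 T x ep tt t y' ->
    `|jacobian_x f t y' - jacobian_x f t y| <= L * `|y' - y|.
  move=> Ty Ty'; apply: mx_norm_le => [|i j]; first by rewrite mulr_ge0// ltW.
  have [_ H] := HLx j; have := mx_norm_ge (partial_x j f t y' - partial_x j f t y) i 0.
  rewrite !mxE => /le_trans; apply; rewrite (le_trans (H t y y' Ty Ty'))// ler_wpM2r//.
  by rewrite (le_trans (le_Lx j))// /L; lra.
have dM : 0 <= d%:R * M by rewrite mulr_ge0// ltW.
have dM1 : 0 < d%:R * M + 1 by apply: ltr_wpDl.
have [rho [rho0 rho1 rhoM]] : exists rho, [/\ 0 < rho, rho <= 1 & d%:R * M * rho <= 2^-1].
  exists (2^-1 / (d%:R * M + 1)); split; first by rewrite divr_gt0// invr_gt0.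
    by rewrite ler_pdivrMr// mul1r; lra.
  by apply: divr_succ_mul_le => //; rewrite invr_gt0.
have C0 := cmax_ge0 rk; have C1 : 0 < cmax rk + 1 by apply: ltr_wpDl.
pose Q := 5 * M * cmax rk + amax rk * @stage_bound R d M.
have Q0 : 0 <= Q by rewrite addr_ge0 ?mulr_ge0 ?(ltW M0)// ?amax_ge0// stage_bound_ge0.
have Q1 : 0 < Q + 1 by apply: ltr_wpDl.
have ep2 : 0 < ep / 2 by rewrite divr_gt0.
have [h1 [h10 h1rho h1c h1ep]] : exists h1, [/\ 0 < h1, h1 <= rho, cmax rk * h1 <= rho & Q * h1 <= ep / 2].
  exists (Num.min rho (Num.min (rho / (cmax rk + 1)) (ep / 2 / (Q + 1)))); split.
  - by rewrite !lt_min rho0 !divr_gt0.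
  - by rewrite ge_min lexx.
  - apply: le_trans (divr_succ_mul_le rho0 C0); rewrite ler_wpM2l//.
    by rewrite !ge_min lexx orbT.
  - apply: le_trans (divr_succ_mul_le ep2 Q0); rewrite ler_wpM2l//.
    by rewrite !ge_min lexx !orbT.
exact: (convergence xsol ep0 M0 L0 fM ftM JM fL ftL JL rho0 rho1 rhoM h10 h1rho h1c h1ep
  rkO Cf (ltW t0T) g0).
Qed.

Theorem theorem7 (R : realType) (d : nat) (t0 T : R) (D : set 'cV[R]_d)
    (f : R -> 'cV[R]_d -> 'cV[R]_d)
    (gamma s : nat) (rk : rk_tableau R s) :
  t0 < T -> open D -> (2 < gamma)%N -> rk_order rk gamma ->
  Ck gamma.+1 t0 T D f ->
  exists C1 C2 : 'cV[R]_d -> R,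
    (forall x0, 0 < C1 x0 /\ 0 < C2 x0) /\
    forall (x0 : 'cV[R]_d) (x : R -> 'cV[R]_d),
      D x0 -> unique_ivp_solution t0 T D f x0 x ->
      exists2 h0 : R, 0 < h0 &
      forall h : R, 0 < h < 1 -> h < h0 ->
      forall (N : nat) (t : nat -> R), time_partition t0 T h N t ->
        (forall n, (n <= N)%N -> t n + h <= T -> stage_times_in rk t0 T (t n) h ->
          `|x (t n + h) - x (t n) - h *: llrk_phi t0 T f rk (t n) (x (t n)) h|
            <= C1 x0 * h ^+ gamma.+1) /\
        (forall y : nat -> 'cV[R]_d,
          (forall n, (n < N)%N -> stage_times_in rk t0 T (t n) (t n.+1 - t n)) ->
          y 0%N = x0 ->
          (forall n, (n < N)%N ->
             y n.+1 = y n + (t n.+1 - t n) *: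
                              llrk_phi t0 T f rk (t n) (y n) (t n.+1 - t n)) ->
          forall n, (n < N)%N ->
            `|x (t n.+1) - y n.+1| <= C2 x0 * h ^+ gamma).
Proof.
move=> t0T oD g2 rkO fCk; have g0 : (0 < gamma)%N by rewrite (leq_trans _ g2).
pose sound (x0 : 'cV[R]_d) (C : R * R) (x : R -> 'cV[R]_d) := exists2 h0 : R, 0 < h0 &
  forall h : R, 0 < h < 1 -> h < h0 -> forall N t, time_partition t0 T h N t ->
    (forall n, (n <= N)%N -> t n + h <= T -> stage_times_in rk t0 T (t n) h ->
      `|x (t n + h) - x (t n) - h *: llrk_phi t0 T f rk (t n) (x (t n)) h|
        <= C.1 * h ^+ gamma.+1) /\
    (forall y : nat -> 'cV[R]_d,
      (forall n, (n < N)%N -> stage_times_in rk t0 T (t n) (t n.+1 - t n)) ->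
      y 0%N = x0 ->
      (forall n, (n < N)%N -> y n.+1 = y n + (t n.+1 - t n) *:
        llrk_phi t0 T f rk (t n) (y n) (t n.+1 - t n)) ->
      forall n, (n < N)%N -> `|x (t n.+1) - y n.+1| <= C.2 * h ^+ gamma).
have /choice[C HC] : forall x0, exists C : R * R, (0 < C.1 /\ 0 < C.2) /\
    forall x, unique_ivp_solution t0 T D f x0 x -> sound x0 C x.
  (* The constants must be functions of [x0] alone, so they are fixed before any solution is given:
     one solution is picked classically, and (1, 1) is the default when there is none. *)
  move=> x0; have [[x [sol xt0 uniq]]|noSol] := pselect (exists x, unique_ivp_solution t0 T D f x0 x);
    last by exists (1, 1); split=> // x xsol; case: noSol; exists x.
  have [C1 [C2 [h0 [C10 C20 h00 H]]]] := convergence_along t0T oD g0 rkO fCk sol.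
  exists (C1, C2); split=> // x' [sol' x't0 _]; exists h0 => // h h01 hh0 N t tP.
  (* Uniqueness transfers the estimates from the chosen solution to the given one, on [t0, T] only;
     hence the checks that the times involved lie there. *)
  have xx' := uniq _ sol' x't0; have [H1 H2] := H h h01 hh0 N t tP.
  have [t00 tN tS] := tP.
  have tT := partition_range (fun n nN => ltW (proj1 (tS n nN))); rewrite t00 tN in tT.
  split=> [n nN nh st|y st y0 yS n nN].
    have nT := tT n nN; rewrite !xx'//; first exact: H1.
    by rewrite nh andbT; case/andP: h01 => h_gt0 _; rewrite ler_wpDr ?(ltW h_gt0)//; case/andP: nT.
  by rewrite xx' ?tT//; apply: H2 => //; rewrite xt0.
exists (fun x0 => (C x0).1), (fun x0 => (C x0).2); split=> [x0|x0 x _ xsol].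
  by have [] := HC x0.
by have [_] := HC x0; exact.
Qed.
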